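(* Let $\theta$ be a non-constant inner function with $\theta(0)=0$, and let $\varphi=\varphi_1+\overline{\varphi_2}$ with $\varphi_1,\varphi_2\in K_\theta$, such that the truncated Toeplitz operator $A^\theta_\varphi$ is bounded on $K_\theta$. Then $A^{\theta}_{\varphi}$ is normal if and only if either \[ \varphi_2-\varphi_2(0)=\alpha\,(\varphi_1-\varphi_1(0)) \] or \[ \varphi_2-\varphi_2(0)=\alpha\,\theta\,\big(\overline{\varphi_1}-\overline{\varphi_1(0)}\big), \] for some unimodular constant $\alpha$.
   Context: $L^2$ is the space of square-integrable functions on the unit circle $\mathbb{T}$, $H^2\subset L^2$ the Hardy space, $P$ the orthogonal projection of $L^2$ onto $H^2$. An inner function is an analytic $\theta$ on the unit disk with $|\theta|=1$ a.e. on $\mathbb{T}$. The model space is $K_\theta=H^2\ominus\theta H^2$ and $P_\theta f=Pf-\theta P(\bar\theta f)$ is the orthogonal projection onto $K_\theta$. For $\varphi\in L^2$, the truncated Toeplitz operator $A^\theta_\varphi f=P_\theta(\varphi f)$ is defined on the dense subspace $K_\theta\cap H^\infty$ and (when bounded) extended to all of $K_\theta$. An operator $T$ is normal if $T^*T=TT^*$. *)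

(* Defs.v *)
(* The unit circle T is parametrized by t in [0, 2*pi]
   (t |-> e^{it}), with normalized Lebesgue measure dt/(2*pi).  Complex numbers
   are R[i] (mathcomp-real-closed) for R : realType; functions on T are
   R -> R[i], only their values on [0, 2*pi] matter, and equality is a.e. *)
From HB Require Import structures.
From mathcomp Require Import all_boot all_order all_algebra.
From mathcomp Require Import all_classical all_reals all_analysis.
From mathcomp Require Import complex.
Set Implicit Arguments. Unset Strict Implicit. Unset Printing Implicit Defensive.
Import Order.TTheory GRing.Theory Num.Theory.
Import numFieldNormedType.Exports.
Local Open Scope classical_set_scope.
Local Open Scope ring_scope.
Local Open Scope complex_scope.

Section Defs.
Variable R : realType.
Local Notation C := R[i].
Local Notation mu := (@lebesgue_measure R).

(* real and imaginary parts *)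
Definition cre (z : C) : R := @complex.Re R z.
Definition cim (z : C) : R := @complex.Im R z.
(* modulus |z| *)
Definition cabs (z : C) : R := @ComplexField.Normc.normc R z.

(* the parameter interval of the unit circle *)
Definition circ : set R := `[0%R, (2 * pi)%R]%classic.

(* measurability and square integrability of a complex function on T *)
Definition cmeasurable (f : R -> C) :=
  measurable_fun circ (fun t => cre (f t)) /\ measurable_fun circ (fun t => cim (f t)).
Definition L2 (f : R -> C) :=
  cmeasurable f /\ mu.-integrable circ (fun t => ((cabs (f t)) ^+ 2)%:E).

(* integral of a complex function over [0, 2pi] *)
Definition cint (f : R -> C) : C :=
  (Rintegral mu circ (fun t => cre (f t))) +i* (Rintegral mu circ (fun t => cim (f t))).

(* L^2 inner product <f, g> = (1/2pi) \int f conj(g), and norm *)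
Definition cinner (f g : R -> C) : C :=
  cint (fun t => f t * (g t)^*) / ((2 * pi)%R)%:C.
Definition cnorm (f : R -> C) : R := Num.sqrt (cre (cinner f f)).

Definition expi (x : R) : C := cos x +i* sin x.

(* n-th Fourier coefficient *)
Definition fourier (f : R -> C) (n : int) : C :=
  cint (fun t => f t * expi (- (n%:~R * t))) / ((2 * pi)%R)%:C.

(* equality almost everywhere on T *)
Definition aeeq (f g : R -> C) := {ae mu, forall t, circ t -> f t = g t}.

(* Hardy space H^2 (boundary functions) *)
Definition H2 (f : R -> C) := L2 f /\ forall n : int, (n < 0)%R -> fourier f n = 0.
Definition ess_bounded (f : R -> C) :=
  exists M : R, {ae mu, forall t, circ t -> cabs (f t) <= M}.
Definition Hinf (f : R -> C) := H2 f /\ ess_bounded f.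

(* value at 0 of (the analytic extension of) an H^2 function *)
Definition value_at_0 (f : R -> C) : C := fourier f 0.

(* inner function (boundary values of a bounded analytic function, unimodular a.e.) *)
Definition inner_fun (th : R -> C) :=
  Hinf th /\ {ae mu, forall t, circ t -> cabs (th t) = 1}.
Definition nonconstant (f : R -> C) := ~ exists c : C, aeeq f (fun _ => c).

(* model space K_theta = H^2 (-) theta H^2 *)
Definition model_space (th f : R -> C) :=
  H2 f /\ forall g, H2 g -> cinner f (fun t => th t * g t) = 0.

(* p = P_theta h : orthogonal projection of h in L^2 onto K_theta *)
Definition is_proj_model (th h p : R -> C) :=
  model_space th p /\ forall g, model_space th g -> cinner (fun t => h t - p t) g = 0.

(* the densely defined TTO f |-> P_theta (phi f) on K_theta \cap H^infty is bounded *)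
Definition tto_bounded (th phi : R -> C) :=
  exists M : R, forall f p, model_space th f -> ess_bounded f ->
    is_proj_model th (fun t => phi t * f t) p -> cnorm p <= M * cnorm f.

(* A is the bounded (linear) extension to K_theta of the TTO with symbol phi *)
Definition is_tto_ext (th phi : R -> C) (A : (R -> C) -> (R -> C)) :=
  [/\ forall f, model_space th f -> model_space th (A f),
      forall (c : C) f g, model_space th f -> model_space th g ->
        aeeq (A (fun t => c * f t + g t)) (fun t => c * A f t + A g t),
      exists M : R, forall f, model_space th f -> cnorm (A f) <= M * cnorm f &
      forall f, model_space th f -> ess_bounded f ->
        is_proj_model th (fun t => phi t * f t) (A f)].

(* B is the adjoint of A on K_theta *)
Definition is_adjoint (th : R -> C) (A B : (R -> C) -> (R -> C)) :=
  (forall f, model_space th f -> model_space th (B f)) /\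
  forall f g, model_space th f -> model_space th g -> cinner (A f) g = cinner f (B g).

(* A is normal on K_theta : A* A = A A* *)
Definition normal_op (th : R -> C) (A : (R -> C) -> (R -> C)) :=
  exists B, is_adjoint th A B /\
    forall f, model_space th f -> aeeq (B (A f)) (A (B f)).

End Defs.

(* Main.v *)
Require Import Defs.
From HB Require Import structures.
From mathcomp Require Import all_boot all_order all_algebra.
From mathcomp Require Import all_classical all_reals all_analysis.
From mathcomp Require Import finmap measurable_realfun complex ring lra zify.
Set Implicit Arguments. Unset Strict Implicit. Unset Printing Implicit Defensive.
Import Order.TTheory GRing.Theory Num.Theory.
Import numFieldNormedType.Exports.
Local Open Scope classical_set_scope.
(* [ring_scope] must come last: both scopes interpret [^*], and inside products
   the definitions of [Defs] use the [ring_scope] conjugation [Num.conj]. *)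
Local Open Scope complex_scope.
Local Open Scope ring_scope.

(** Subtract the constant [c = phi1(0) + conj phi2(0)] from [A] and put
    [f = phi1 - phi1(0)], [g = phi2 - phi2(0)], so that the symbol becomes
    [f + conj g].  With [S* k = conj z (k - k(0))] and [f~ = th * conj f], every
    [k] in [K_th] satisfies
      [A k = z * A (S* k) + k(0) f + <k, g> - <k, f~> th],
    and likewise for the adjoint [B] with [f] and [g] exchanged.  Hence the defect
    [Q(k, l) = <A k, A l> - <B k, B l>], which vanishes identically iff [A] is
    normal, differs from [Q(S* k, S* l)] by terms built from
    [k(0)], [l(0)], [||f||^2 - ||g||^2], [B (S* f) - A (S* g)] and
      [<k,g><g,l> - <k,f~><f~,l> - <k,f><f,l> + <k,g~><g~,l>].
    If [Q = 0], the resulting relations at [(1,1)], [(f,f)], [(f,f~)] force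
    [(|<g,f>|^2 - p^2)(|<g,f~>|^2 - p^2) = 0] with [p = ||f||^2 = ||g||^2], and the
    equality case of Cauchy-Schwarz gives one of the two alternatives.  Conversely
    each alternative makes all those terms vanish, so
    [Q(k, l) = Q(S*^n k, S*^n l)], which tends to 0.  The adjoint is
    [C A C] for the conjugation [C f = th * conj (z f)]; extending identities from
    bounded functions to [K_th] rests on the density of trigonometric polynomials
    in [L^2]. *)

(** * Complex integrals and square integrable functions *)

(** Multiplication by the symbol can take an unbounded element of [K_th] out of L^2, so the
    definition of [A] constrains it directly only on bounded functions. This obstacle shapes the
    proof: [A k] is always tested against bounded [l], with the symbol moved onto [l], and every
    such identity needs bounded elements to be dense in [K_th]. They are, because the projection of
    an analytic polynomial onto [K_th] is again bounded. The shift formula comes from pairing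
    [A (S* k)] with [S* l]: the two factors [conj z] cancel, and what remains differs from the
    pairing of [A k] with [l] by rank one terms only. The product [z * A (S* k)] can leave [K_th]
    only along [th], whence the last term. The condition [th(0) = 0] puts the constants in [K_th],
    so [f] and [g] stay in [K_th] after their means are removed; then [f~] and [g~] lie there too,
    with value 0 at the origin, and may be used as arguments of the defect. *)

Section ComplexIntegral.
Variable R : realType.
Local Notation C := R[i].
Local Notation mu := (@lebesgue_measure R).
Local Notation circ := (@circ R).
Implicit Types (f g h : R -> C) (a c : C).

Lemma measurable_circ : measurable circ.
Proof. exact: measurable_itv. Qed.
#[local] Hint Resolve measurable_circ : core.

Lemma mu_circ : mu circ = (2 * pi)%:E.
Proof. by rewrite /circ lebesgue_measure_itv/= lte_fin mulr_gt0 ?pi_gt0// oppr0 adde0. Qed.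

Lemma ae_imp (P Q : R -> Prop) : (forall t, P t -> Q t) ->
  {ae mu, forall t, P t} -> {ae mu, forall t, Q t}.
Proof. by move=> PQ; apply: (@filterS _ _ (ae_filter_ringOfSetsType mu)). Qed.
Lemma ae_and (P Q : R -> Prop) : {ae mu, forall t, P t} -> {ae mu, forall t, Q t} ->
  {ae mu, forall t, P t /\ Q t}.
Proof. by move=> p q; apply: (@filterI _ _ (ae_filter_ringOfSetsType mu)). Qed.
Lemma ae_all (P : R -> Prop) : (forall t, P t) -> {ae mu, forall t, P t}.
Proof. by move=> p; apply: (@filterE _ _ (ae_filter_ringOfSetsType mu)). Qed.

Lemma creD (x y : C) : cre (x + y) = cre x + cre y. Proof. by case: x; case: y. Qed.
Lemma cimD (x y : C) : cim (x + y) = cim x + cim y. Proof. by case: x; case: y. Qed.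
Lemma creN (x : C) : cre (- x) = - cre x. Proof. by case: x. Qed.
Lemma cimN (x : C) : cim (- x) = - cim x. Proof. by case: x. Qed.
Lemma creM (x y : C) : cre (x * y) = cre x * cre y - cim x * cim y.
Proof. by case: x; case: y. Qed.
Lemma cimM (x y : C) : cim (x * y) = cre x * cim y + cim x * cre y.
Proof. by case: x => a b; case: y => c d. Qed.
Lemma creJ (x : C) : cre x^* = cre x. Proof. by case: x. Qed.
Lemma cimJ (x : C) : cim x^* = - cim x. Proof. by case: x. Qed.
Definition creimE := (creD, cimD, creN, cimN, creM, cimM, creJ, cimJ).

Lemma cabs2E (x : C) : cabs x ^+ 2 = cre x ^+ 2 + cim x ^+ 2.
Proof. by case: x => a b; rewrite /cabs /= sqr_sqrtr // addr_ge0 ?sqr_ge0. Qed.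

Lemma complex_ext (x y : C) : cre x = cre y -> cim x = cim y -> x = y.
Proof. by case: x => a b; case: y => c d /= -> ->. Qed.

Lemma mulcJ (x : C) : x * x^* = (cabs x ^+ 2)%:C.
Proof. by rewrite cabs2E; case: x => a b; apply: complex_ext; rewrite !creimE /=; ring. Qed.

Lemma cconjM (x y : C) : (x * y)^* = x^* * y^*. Proof. exact: rmorphM. Qed.
Lemma cconjD (x y : C) : (x + y)^* = x^* + y^*. Proof. exact: rmorphD. Qed.
Lemma cconjB (x y : C) : (x - y)^* = x^* - y^*. Proof. exact: rmorphB. Qed.
Lemma cconjK (x : C) : x^*^* = x. Proof. exact: conjcK. Qed.
Lemma cconj1 : (1 : C)^* = 1. Proof. exact: rmorph1. Qed.
Lemma cconj0 : (0 : C)^* = 0. Proof. exact: rmorph0. Qed.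

Lemma realCV (x : R) : (x%:C)^-1 = (x^-1)%:C :> C.
Proof. exact/esym/fmorphV. Qed.

Lemma realCM (x y : R) : (x * y)%:C = x%:C * y%:C :> C.
Proof. exact: rmorphM. Qed.

Lemma cabs_ge0 (x : C) : 0 <= cabs x. Proof. by case: x => a b; rewrite sqrtr_ge0. Qed.

Definition cL1 f := mu.-integrable circ (fun t => (cre (f t))%:E) /\
  mu.-integrable circ (fun t => (cim (f t))%:E).

Lemma cintD f g : cL1 f -> cL1 g -> cint (fun t => f t + g t) = cint f + cint g.
Proof.
move=> [f1 f2] [g1 g2]; rewrite /cint; apply: complex_ext; rewrite !creimE /=.
- rewrite -RintegralD //; congr Rintegral; apply/funext => t; exact: creD.
- rewrite -RintegralD //; congr Rintegral; apply/funext => t; exact: cimD.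
Qed.

Lemma cintZ c f : cL1 f -> cint (fun t => c * f t) = c * cint f.
Proof.
move=> [f1 f2]; have i1 k : mu.-integrable circ (EFin \o (fun t => k * cre (f t))).
  by rewrite /comp; under eq_fun do rewrite EFinM; apply: integrableZl.
have i2 k : mu.-integrable circ (EFin \o (fun t => k * cim (f t))).
  by rewrite /comp; under eq_fun do rewrite EFinM; apply: integrableZl.
rewrite /cint; apply: complex_ext; rewrite !creimE /=.
- rewrite -!RintegralZl// -RintegralB //; congr Rintegral; apply/funext => t; exact: creM.
- rewrite -!RintegralZl// -RintegralD //; congr Rintegral; apply/funext => t; exact: cimM.
Qed.

Lemma cintJ f : cL1 f -> cint (fun t => (f t)^*) = (cint f)^*.
Proof.
move=> [f1 f2]; rewrite /cint; apply: complex_ext; rewrite !creimE /=.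
- congr Rintegral; apply/funext => t; exact: creJ.
- rewrite -[RHS]mulN1r -RintegralZl//; congr Rintegral; apply/funext => t.
  by rewrite mulN1r cimJ.
Qed.

Lemma cint_ae f g : cmeasurable f -> cmeasurable g -> aeeq f g -> cint f = cint g.
Proof.
move=> [f1 f2] [g1 g2] fg; rewrite /cint /Rintegral.
have fgt : {ae mu, forall t, circ t -> cre (f t) = cre (g t) /\ cim (f t) = cim (g t)}.
  by apply: ae_imp fg => t h tc; rewrite (h tc).
have e1 : ae_eq mu circ (EFin \o (@cre R \o f)) (EFin \o (@cre R \o g)).
  by apply: (ae_imp _ fgt) => t h tc /=; have [-> _] := h tc.
have e2 : ae_eq mu circ (EFin \o (@cim R \o f)) (EFin \o (@cim R \o g)).
  by apply: (ae_imp _ fgt) => t h tc /=; have [_ ->] := h tc.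
by congr (fine _ +i* fine _); apply: ae_eq_integral => //; exact/measurable_EFinP.
Qed.

(** [cinner f g] unfolds to the [cmean] of [f * g^*], so the algebra of the inner product reduces to
    that of the mean. *)
Definition cmean f := cint f / ((2 * pi)%R)%:C.

Lemma cmeanD f g : cL1 f -> cL1 g -> cmean (fun t => f t + g t) = cmean f + cmean g.
Proof. by move=> f1 g1; rewrite /cmean cintD // mulrDl. Qed.
Lemma cmeanZ c f : cL1 f -> cmean (fun t => c * f t) = c * cmean f.
Proof. by move=> f1; rewrite /cmean cintZ // mulrA. Qed.
Lemma cmeanJ f : cL1 f -> cmean (fun t => (f t)^*) = (cmean f)^*.
Proof.
move=> f1; rewrite /cmean cintJ //; apply/esym; apply: (etrans (rmorphM _ _ _)).
by rewrite realCV; congr (_ * _); exact: conjc_real.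
Qed.

Lemma cmeasD f g : cmeasurable f -> cmeasurable g -> cmeasurable (fun t => f t + g t).
Proof.
move=> [f1 f2] [g1 g2]; split.
- under eq_fun do rewrite creD; exact: measurable_funD.
- under eq_fun do rewrite cimD; exact: measurable_funD.
Qed.
Lemma cmeasM f g : cmeasurable f -> cmeasurable g -> cmeasurable (fun t => f t * g t).
Proof.
move=> [f1 f2] [g1 g2]; split.
- by under eq_fun do rewrite creM; apply: measurable_funB; apply: measurable_funM.
- by under eq_fun do rewrite cimM; apply: measurable_funD; apply: measurable_funM.
Qed.
Lemma cmeasJ f : cmeasurable f -> cmeasurable (fun t => (f t)^*).
Proof.
move=> [f1 f2]; split.
- by under eq_fun do rewrite creJ.
- by under eq_fun do rewrite cimJ; apply: measurableT_comp.
Qed.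
Lemma cmeas_cst c : cmeasurable (fun=> c).
Proof. by split; apply: measurable_cst. Qed.

Lemma L2_meas f : L2 f -> cmeasurable f. Proof. by case. Qed.

Lemma cL1_dom f (g : R -> R) : cmeasurable f -> mu.-integrable circ (EFin \o g) ->
  (forall t, circ t -> `|cre (f t)| <= g t) ->
  (forall t, circ t -> `|cim (f t)| <= g t) -> cL1 f.
Proof.
move=> [f1 f2] gi h1 h2; split; (apply: (le_integrable _ _ _ gi) => //;
  first by exact/measurable_EFinP); move=> t tc /=;
  by rewrite lee_fin (le_trans _ (ler_norm _))//; (apply: h1 || apply: h2).
Qed.

(** The real and imaginary parts of a product [x * y] are bounded by [|x|^2 + |y|^2]. *)
Lemma L2_prod f g : L2 f -> L2 g -> cL1 (fun t => f t * g t).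
Proof.
move=> [fm fi] [gm gi]; apply: (cL1_dom _ (integrableD _ fi gi)) => //; first exact: cmeasM.
- move=> t _ /=; rewrite !cabs2E creM; move: (cre _) (cim _) (cre _) (cim _) => a b c d.
  rewrite ler_norml; apply/andP.
  have := (sqr_ge0 (a - c), sqr_ge0 (b - d), sqr_ge0 (a + c), sqr_ge0 (b + d),
    sqr_ge0 (a - d), sqr_ge0 (b - c), sqr_ge0 (a + d), sqr_ge0 (b + c)).
  by case=> [[[[[[[h1 h2] h3] h4] h5] h6] h7] h8]; split; nra.
- move=> t _ /=; rewrite !cabs2E cimM; move: (cre _) (cim _) (cre _) (cim _) => a b c d.
  rewrite ler_norml; apply/andP.
  have := (sqr_ge0 (a - c), sqr_ge0 (b - d), sqr_ge0 (a + c), sqr_ge0 (b + d),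
    sqr_ge0 (a - d), sqr_ge0 (b - c), sqr_ge0 (a + d), sqr_ge0 (b + c)).
  by case=> [[[[[[[h1 h2] h3] h4] h5] h6] h7] h8]; split; nra.
Qed.

(** The usual way to prove square integrability below: the factor [M] and the exceptional null set
    cover bounded multipliers, conjugates and a.e. modifications alike. *)
Lemma L2_dom f g : cmeasurable f -> L2 g ->
  (exists M, {ae mu, forall t, circ t -> cabs (f t) <= M * cabs (g t)}) -> L2 f.
Proof.
move=> fm [gm gi] [M h]; split => //.
have mf : measurable_fun circ (fun t => (cabs (f t) ^+ 2)%:E).
  apply/measurable_EFinP; rewrite (_ : (fun t => _) = (fun t => cre (f t) ^+ 2 + cim (f t) ^+ 2)).
    by case: fm => f1 f2; apply: measurable_funD; apply: measurable_funX.
  by apply/funext => t; rewrite cabs2E.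
have gi' : mu.-integrable circ (fun t => (M ^+ 2 * cabs (g t) ^+ 2)%:E).
  by under eq_fun do rewrite EFinM; exact: integrableZl.
apply/integrableP; split => //.
case/integrableP : gi' => mg; apply: le_lt_trans.
apply: ae_ge0_le_integral => //; try by apply: measurableT_comp.
apply: ae_imp h => t h tc; rewrite /= ger0_norm ?sqr_ge0// ger0_norm; last first.
  by rewrite mulr_ge0 ?sqr_ge0.
rewrite lee_fin -exprMn ler_sqr ?nnegrE ?cabs_ge0 //.
  exact: h.
exact: le_trans (cabs_ge0 (f t)) (h tc).
Qed.

Lemma L2_ae f g : cmeasurable g -> aeeq f g -> L2 f -> L2 g.
Proof.
move=> gm fg f2; apply: (L2_dom gm f2); exists 1; apply: ae_imp fg => t h tc.
by rewrite mul1r h.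
Qed.

Lemma cabsM (x y : C) : cabs (x * y) = cabs x * cabs y.
Proof. exact: ComplexField.Normc.normcM. Qed.
Lemma cabsJ (x : C) : cabs x^* = cabs x.
Proof. by case: x => a b; rewrite /cabs /= sqrrN. Qed.
Lemma cabsN (x : C) : cabs (- x) = cabs x.
Proof. by case: x => a b; rewrite /cabs /= !sqrrN. Qed.
Lemma cabs_real (x : R) : cabs x%:C = `|x|.
Proof. by rewrite /cabs /= expr0n /= addr0 sqrtr_sqr. Qed.
Lemma cabs0 : cabs (0 : C) = 0.
Proof. by rewrite (_ : 0 = (0 : R)%:C) // cabs_real normr0. Qed.
Lemma cabs1 : cabs (1 : C) = 1.
Proof. by rewrite (_ : 1 = (1 : R)%:C) // cabs_real normr1. Qed.
Lemma cabs0_eq0 (x : C) : cabs x = 0 -> x = 0.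
Proof. exact: ComplexField.Normc.eq0_normc. Qed.
Lemma cabsD (x y : C) : cabs (x + y) <= cabs x + cabs y.
Proof. exact: le_normcD. Qed.

Lemma L2D f g : L2 f -> L2 g -> L2 (fun t => f t + g t).
Proof.
move=> [fm fi] [gm gi]; split; first exact: cmeasD.
have mf : measurable_fun circ (fun t => (cabs (f t + g t) ^+ 2)%:E).
  apply/measurable_EFinP; rewrite (_ : (fun t => _) = (fun t => cre (f t + g t) ^+ 2 + cim (f t + g t) ^+ 2)).
    by have [f1 f2] := cmeasD fm gm; apply: measurable_funD; apply: measurable_funX.
  by apply/funext => t; rewrite cabs2E.
have dom : mu.-integrable circ (fun t => (2 * (cabs (f t) ^+ 2 + cabs (g t) ^+ 2))%:E).
  by under eq_fun do rewrite EFinM EFinD; apply: integrableZl => //;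
    exact: (integrableD _ fi gi).
apply: (le_integrable _ _ _ dom) => // t _ /=.
rewrite lee_fin !cabs2E !creimE; move: (cre _) (cim _) (cre _) (cim _) => a b c d.
have := (sqr_ge0 (a - c), sqr_ge0 (b - d), sqr_ge0 (a - d), sqr_ge0 (b - c),
  sqr_ge0 (a - b), sqr_ge0 (c - d)).
case=> [[[[[h1 h2] h3] h4] h5] h6].
rewrite !ger0_norm; try nra.
by rewrite addr_ge0 ?sqr_ge0.
Qed.

Lemma circ_integrable_cst (k : R) : mu.-integrable circ (EFin \o cst k).
Proof.
apply/integrableP; split; first by apply/measurable_EFinP; apply: measurable_cst.
under eq_integral do rewrite /=.
rewrite integral_cst //= mu_circ -EFinM ltry //.
Qed.

Lemma L2_cst c : L2 (fun=> c).
Proof. by split; [exact: cmeas_cst|exact: circ_integrable_cst]. Qed.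

Lemma L2Mb f g : cmeasurable f -> ess_bounded f -> L2 g -> L2 (fun t => f t * g t).
Proof.
move=> fm [M h] g2; apply: (L2_dom _ g2); first by apply: cmeasM => //; case: g2.
exists M; apply: (ae_imp _ h) => t ht tc; rewrite cabsM ler_wpM2r ?cabs_ge0 //; exact: ht.
Qed.

Lemma L2J f : L2 f -> L2 (fun t => (f t)^*).
Proof.
move=> f2; apply: (L2_dom _ f2); first by apply: cmeasJ; case: f2.
by exists 1; apply: ae_all => t tc; rewrite cabsJ mul1r.
Qed.

Lemma ess_bounded_cst c : ess_bounded (fun=> c).
Proof. by exists (cabs c); apply: ae_all. Qed.

Lemma ess_boundedD f g : ess_bounded f -> ess_bounded g -> ess_bounded (fun t => f t + g t).
Proof.
move=> [M hM] [N hN]; exists (M + N); apply: (ae_imp _ (ae_and hM hN)) => t [h1 h2] tc.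
by apply: le_trans (cabsD _ _) _; apply: lerD; [exact: h1|exact: h2].
Qed.

Lemma ess_boundedM f g : ess_bounded f -> ess_bounded g -> ess_bounded (fun t => f t * g t).
Proof.
move=> [M hM] [N hN]; exists (M * N); apply: (ae_imp _ (ae_and hM hN)) => t [h1 h2] tc.
by rewrite cabsM; apply: ler_pM; rewrite ?cabs_ge0 //; [exact: h1|exact: h2].
Qed.

Lemma ess_boundedJ f : ess_bounded f -> ess_bounded (fun t => (f t)^*).
Proof. by move=> [M h]; exists M; apply: (ae_imp _ h) => t ht tc; rewrite cabsJ; apply: ht. Qed.

Lemma L2Z c f : L2 f -> L2 (fun t => c * f t).
Proof. by move=> f2; exact: L2Mb (cmeas_cst _) (ess_bounded_cst _) f2. Qed.

Lemma L2N f : L2 f -> L2 (fun t => - f t).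
Proof.
move=> f2; rewrite (_ : (fun t => _) = (fun t => -1 * f t)); first exact: L2Z.
by apply/funext => t; rewrite mulN1r.
Qed.

Lemma L2B f g : L2 f -> L2 g -> L2 (fun t => f t - g t).
Proof. by move=> f2 g2; apply: L2D => //; apply: L2N. Qed.

Lemma L2_prodJ f g : L2 f -> L2 g -> cL1 (fun t => f t * (g t)^*).
Proof. by move=> f2 g2; apply: L2_prod => //; apply: L2J. Qed.

Lemma cinnerDl f g h : L2 f -> L2 g -> L2 h ->
  cinner (fun t => f t + g t) h = cinner f h + cinner g h.
Proof.
move=> f2 g2 h2; rewrite -[RHS]cmeanD; try exact: L2_prodJ.
by congr cmean; apply/funext => t; rewrite mulrDl.
Qed.

Lemma cinnerZl c f h : L2 f -> L2 h -> cinner (fun t => c * f t) h = c * cinner f h.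
Proof.
move=> f2 h2; rewrite -[RHS]cmeanZ; try exact: L2_prodJ.
by congr cmean; apply/funext => t; rewrite mulrA.
Qed.

Lemma cinnerC f h : L2 f -> L2 h -> cinner h f = (cinner f h)^*.
Proof.
move=> f2 h2; rewrite -[RHS]cmeanJ; try exact: L2_prodJ.
by congr cmean; apply/funext => t; rewrite cconjM cconjK mulrC.
Qed.

Lemma cinnerNl f h : L2 f -> L2 h -> cinner (fun t => - f t) h = - cinner f h.
Proof.
move=> f2 h2; transitivity (cinner (fun t => -1 * f t) h).
  by rewrite (_ : (fun t => - f t) = (fun t => -1 * f t)) //; apply/funext => t; rewrite mulN1r.
by rewrite cinnerZl // mulN1r.
Qed.

Lemma cinnerBl f g h : L2 f -> L2 g -> L2 h ->
  cinner (fun t => f t - g t) h = cinner f h - cinner g h.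
Proof. by move=> f2 g2 h2; rewrite -cinnerNl // -cinnerDl //; apply: L2N. Qed.

Lemma cinnerDr f g h : L2 f -> L2 g -> L2 h ->
  cinner h (fun t => f t + g t) = cinner h f + cinner h g.
Proof.
move=> f2 g2 h2; rewrite (cinnerC (L2D f2 g2) h2) cinnerDl // (cinnerC f2 h2) (cinnerC g2 h2).
by rewrite rmorphD.
Qed.

Lemma cinnerZr c f h : L2 f -> L2 h -> cinner h (fun t => c * f t) = c^* * cinner h f.
Proof.
move=> f2 h2; rewrite (cinnerC (L2Z c f2) h2) cinnerZl // (cinnerC f2 h2).
by rewrite rmorphM.
Qed.

Lemma cinnerNr f h : L2 f -> L2 h -> cinner h (fun t => - f t) = - cinner h f.
Proof.
move=> f2 h2; rewrite (cinnerC (L2N f2) h2) cinnerNl // (cinnerC f2 h2).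
by rewrite rmorphN.
Qed.

Lemma cinnerBr f g h : L2 f -> L2 g -> L2 h ->
  cinner h (fun t => f t - g t) = cinner h f - cinner h g.
Proof. by move=> f2 g2 h2; rewrite -cinnerNr // -cinnerDr //; apply: L2N. Qed.

Lemma cmean_ae f g : cmeasurable f -> cmeasurable g -> aeeq f g -> cmean f = cmean g.
Proof. by move=> fm gm fg; rewrite /cmean (cint_ae fm gm fg). Qed.

Lemma cinner_ae f f' g g' : cmeasurable f -> cmeasurable f' -> cmeasurable g -> cmeasurable g' ->
  aeeq f f' -> aeeq g g' -> cinner f g = cinner f' g'.
Proof.
move=> fm fm' gm gm' ff gg; apply: cmean_ae.
- by apply: cmeasM => //; apply: cmeasJ.
- by apply: cmeasM => //; apply: cmeasJ.
- by apply: (ae_imp _ (ae_and ff gg)) => t [h1 h2] tc; rewrite h1 ?h2.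
Qed.

Definition sqnorm f : R := cre (cinner f f).

Lemma twopi_gt0 : 0 < 2 * pi :> R. Proof. by rewrite mulr_gt0 ?pi_gt0. Qed.

Lemma cinner_selfE f :
  cinner f f = ((Rintegral mu circ (fun t => cabs (f t) ^+ 2)) / (2 * pi))%:C.
Proof.
rewrite realCM -realCV /cinner /cint; congr (_ * _); apply: complex_ext => /=.
- by congr Rintegral; apply/funext => t; rewrite mulcJ.
- rewrite (_ : (fun t => _) = cst 0); last by apply/funext => t; rewrite mulcJ.
  by rewrite Rintegral_cst // mul0r.
Qed.

Lemma sqnormE f : sqnorm f = (Rintegral mu circ (fun t => cabs (f t) ^+ 2)) / (2 * pi).
Proof. by rewrite /sqnorm cinner_selfE. Qed.

Lemma cinner_self f : cinner f f = (sqnorm f)%:C.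
Proof. by rewrite sqnormE cinner_selfE. Qed.

Lemma sqnorm_ge0 f : 0 <= sqnorm f.
Proof.
rewrite sqnormE divr_ge0 ?(ltW twopi_gt0) //; apply: Rintegral_ge0 => t _.
exact: sqr_ge0.
Qed.

Lemma sqnorm_eq0 f : L2 f -> sqnorm f = 0 -> aeeq f (fun=> 0).
Proof.
move=> [fm fi] /eqP; rewrite sqnormE mulf_eq0 invr_eq0 (gt_eqF twopi_gt0) orbF => /eqP h.
have mf : measurable_fun circ (fun t => (cabs (f t) ^+ 2)%:E) by exact: measurable_int fi.
have : (\int[mu]_(x in circ) `|(cabs (f x) ^+ 2)%:E| = 0)%E.
  under eq_integral do rewrite gee0_abs ?lee_fin ?sqr_ge0 //.
  rewrite -(fineK (integrable_fin_num _ fi)) //.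
  by rewrite -[X in X%:E]/(Rintegral mu circ (fun t => cabs (f t) ^+ 2)) h.
move/ae_eq_integral_abs => /(_ measurable_circ mf).
apply: ae_imp => t ht tc; apply: cabs0_eq0; apply/eqP; rewrite -sqrf_eq0.
by have [->] := ht tc.
Qed.

Lemma cnormE f : cnorm f = Num.sqrt (sqnorm f). Proof. by []. Qed.

Lemma sqnorm_ae f g : cmeasurable f -> cmeasurable g -> aeeq f g -> sqnorm f = sqnorm g.
Proof. by move=> fm gm fg; rewrite /sqnorm (cinner_ae fm gm fm gm fg fg). Qed.

(** The squared norm of [f - y <f,g> g] is nonnegative for every real [y], which gives a real
    quadratic inequality in [y]. *)
Lemma cauchy_schwarz f g : L2 f -> L2 g -> cabs (cinner f g) ^+ 2 <= sqnorm f * sqnorm g.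
Proof.
move=> f2 g2.
have key a b : 0 <= cabs a ^+ 2 * sqnorm f + cabs b ^+ 2 * sqnorm g + 2 * cre (a * b^* * cinner f g).
  have := sqnorm_ge0 (fun t => a * f t + b * g t).
  have af : L2 (fun t => a * f t) by exact: L2Z.
  have bg : L2 (fun t => b * g t) by exact: L2Z.
  rewrite /sqnorm cinnerDl ?cinnerDr ?cinnerZl ?cinnerZr //; try exact: L2D.
  rewrite (cinnerC f2 g2) !cinner_self !cabs2E !creimE /=.
  move=> H; apply: (le_trans H); rewrite le_eqVlt; apply/orP; left; apply/eqP.
  by rewrite !mulr0 !mul0r; ring.
have k2 y : 0 <= sqnorm f + y ^+ 2 * cabs (cinner f g) ^+ 2 * sqnorm g - 2 * y * cabs (cinner f g) ^+ 2.
  have := key 1 (- y%:C * cinner f g).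
  rewrite !cabs2E !creimE /=.
  move=> H; apply: (le_trans H); rewrite le_eqVlt; apply/orP; left; apply/eqP; ring.
have u0 := sqr_ge0 (cabs (cinner f g)); move: (cabs _ ^+ 2) u0 k2 => u u0 k2.
have F0 := sqnorm_ge0 f; have [G0|G0] := eqVneq (sqnorm g) 0.
  rewrite G0 mulr0; rewrite leNgt; apply/negP => up.
  (* The quadratic term is absent, and this [y] turns the inequality into [0 <= -1]. *)
  have := k2 ((sqnorm f + 1) / (2 * u)); rewrite G0 mulr0 addr0.
  rewrite (_ : 2 * _ * u = sqnorm f + 1); first by lra.
  by field; rewrite gt_eqF.
have Gp : 0 < sqnorm g by rewrite lt_neqAle eq_sym G0 sqnorm_ge0.
(* The minimum of the quadratic in [y]. *)
have := k2 (sqnorm g)^-1; rewrite (_ : _ - _ = (sqnorm f * sqnorm g - u) / sqnorm g); last by field.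
by rewrite pmulr_lge0 ?invr_gt0 // subr_ge0.
Qed.

End ComplexIntegral.

(** * Trigonometric polynomials *)

Section Trigonometric.
Variable R : realType.
Local Notation C := R[i].
Local Notation mu := (@lebesgue_measure R).
Local Notation circ := (@circ R).
Implicit Types (f g h : R -> C) (a c : C).
#[local] Hint Extern 0 (measurable _) => (exact: measurable_circ) : core.

Lemma expiD (x y : R) : expi (x + y) = expi x * expi y :> C.
Proof. by apply: complex_ext; rewrite !creimE /= ?cosD ?sinD //; ring. Qed.
Lemma expiN (x : R) : expi (- x) = (expi x)^* :> C.
Proof. by apply: complex_ext; rewrite /= ?cosN ?sinN. Qed.
Lemma expi0 : expi 0 = 1 :> C.
Proof. by apply: complex_ext; rewrite /= ?cos0 ?sin0. Qed.
Lemma cabs_expi (x : R) : cabs (expi x) = 1.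
Proof. by rewrite /cabs /= cos2Dsin2 sqrtr1. Qed.

Definition zn (n : int) (t : R) : C := expi (n%:~R * t).

Lemma znD m n t : zn (m + n) t = zn m t * zn n t.
Proof. by rewrite /zn rmorphD /= mulrDl expiD. Qed.
Lemma znN n t : zn (- n) t = (zn n t)^*.
Proof. by rewrite /zn rmorphN /= mulNr expiN. Qed.
Lemma zn0 t : zn 0 t = 1.
Proof. by rewrite /zn mul0r expi0. Qed.
Lemma cabs_zn n t : cabs (zn n t) = 1.
Proof. exact: cabs_expi. Qed.
Lemma znJ n t : zn n t * (zn n t)^* = 1.
Proof. by rewrite mulcJ cabs_zn expr1n. Qed.

Lemma fourierE f n : fourier f n = cinner f (zn n).
Proof. by congr (cint _ / _); apply/funext => t; rewrite expiN. Qed.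

Lemma zn_meas n : cmeasurable (zn n).
Proof.
have mt : measurable_fun circ (fun t : R => n%:~R * t :> R).
  by apply: measurable_funM; [exact: measurable_cst|exact: measurable_id].
split; rewrite /zn /=.
- apply: (measurableT_comp _ mt) => //; apply: continuous_measurable_fun; exact: continuous_cos.
- apply: (measurableT_comp _ mt) => //; apply: continuous_measurable_fun; exact: continuous_sin.
Qed.

Lemma zn_bounded n : ess_bounded (zn n).
Proof. by exists 1; apply: ae_all => t _; rewrite cabs_zn. Qed.

Lemma L2_bounded f : cmeasurable f -> ess_bounded f -> L2 f.
Proof.
move=> fm fb; rewrite (_ : f = fun t => f t * 1); first exact: L2Mb fm fb (L2_cst _).
by apply/funext => t; rewrite mulr1.
Qed.

Lemma zn_L2 n : L2 (zn n).
Proof. exact: L2_bounded (zn_meas n) (zn_bounded n). Qed.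

Lemma sqnorm_bound q f (M : R) : cmeasurable q -> L2 f -> 
  {ae mu, forall t, circ t -> cabs (q t) <= M} ->
  sqnorm (fun t => q t * f t) <= M ^+ 2 * sqnorm f.
Proof.
move=> qm f2 qM; have qf : L2 (fun t => q t * f t) by apply: L2Mb => //; exists M.
rewrite !sqnormE mulrA ler_pM2r ?invr_gt0 ?twopi_gt0 //.
case: (f2) (qf) => [fm fi] [qfm qfi].
have Mi : mu.-integrable circ (fun t => (M ^+ 2 * cabs (f t) ^+ 2)%:E).
  by under eq_fun do rewrite EFinM; exact: integrableZl.
have -> : M ^+ 2 * Rintegral mu circ (fun t => cabs (f t) ^+ 2) =
    Rintegral mu circ (fun t => M ^+ 2 * cabs (f t) ^+ 2) by rewrite RintegralZl.
apply: fine_le; rewrite ?integrable_fin_num //.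
have m1 := measurable_int _ fi. have m2 := measurable_int _ qfi.
apply: ae_ge0_le_integral => //.
- by move=> t _; rewrite lee_fin sqr_ge0.
- by move=> t _; rewrite lee_fin mulr_ge0 ?sqr_ge0.
- exact: measurable_int _ Mi.
- apply: (ae_imp _ qM) => t qt tc; rewrite lee_fin -exprMn cabsM.
  by rewrite lerXn2r ?nnegrE ?mulr_ge0 ?cabs_ge0 ?(le_trans (cabs_ge0 _) (qt tc)) // ler_wpM2r ?cabs_ge0 ?qt.
Qed.

Lemma sqnormD f g : L2 f -> L2 g -> sqnorm (fun t => f t + g t) <= 2 * sqnorm f + 2 * sqnorm g.
Proof.
move=> f2 g2; have := sqnorm_ge0 (fun t => f t - g t).
rewrite /sqnorm cinnerBl ?cinnerBr ?cinnerDl ?cinnerDr //; [|exact: L2D|exact: L2B].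
by rewrite !creimE; lra.
Qed.

Lemma sqnormN f : sqnorm (fun t => - f t) = sqnorm f.
Proof. by rewrite /sqnorm; congr cre; congr cmean; apply/funext => t; rewrite rmorphN mulrNN. Qed.

Lemma sqnormZ c f : L2 f -> sqnorm (fun t => c * f t) = cabs c ^+ 2 * sqnorm f.
Proof.
move=> f2; rewrite /sqnorm cinnerZl ?cinnerZr //; last exact: L2Z.
by rewrite mulrA mulcJ cinner_self !creimE /= mul0r subr0.
Qed.

Lemma sqnorm_dct (f_ : nat -> R -> C) g : (forall n, cmeasurable (f_ n)) -> L2 g ->
  (forall n t, circ t -> cabs (f_ n t) <= cabs (g t)) ->
  (forall t, circ t -> (fun n => cabs (f_ n t)) @ \oo --> (0 : R)) ->
  forall e : R, 0 < e -> exists n, sqnorm (f_ n) < e.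
Proof.
move=> fm [gm gi] fg f0 e e0.
have f2 n : L2 (f_ n).
  apply: (L2_dom (fm n) (conj gm gi)); exists 1; apply: ae_all => t tc.
  by rewrite mul1r fg.
have c1 : {ae mu, forall x, circ x -> (fun n => (cabs (f_ n x) ^+ 2)%:E) @ \oo --> 0%E}.
  apply: ae_all => t tc; apply: cvg_EFin; first by apply: nearW.
  rewrite /comp /= -[X in _ --> X](mulr0 (0 : R)).
  by under eq_fun do rewrite expr2; apply: cvgM; exact: f0.
have c2 : {ae mu, forall x n, circ x -> (`|(cabs (f_ n x) ^+ 2)%:E| <= (cabs (g x) ^+ 2)%:E)%E}.
  apply: ae_all => t n tc; rewrite gee0_abs ?lee_fin ?sqr_ge0 //.
  by rewrite lerXn2r ?nnegrE ?cabs_ge0 // fg.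
have [_ _] := @dominated_convergence _ _ _ mu circ (@measurable_circ R)
  (fun n t => (cabs (f_ n t) ^+ 2)%:E) (fun=> 0%E) (fun t => (cabs (g t) ^+ 2)%:E)
  (fun n => measurable_int _ (f2 n).2) (measurable_cst _) c1 gi c2.
rewrite integral0 => /fine_cvg /cvgr0Pnorm_lt /(_ (e * (2 * pi))).
rewrite mulr_gt0 ?twopi_gt0 // => /(_ isT) [n _ /(_ n (leqnn n)) /= hn].
exists n; rewrite sqnormE ltr_pdivrMr ?twopi_gt0 //.
exact: le_lt_trans (ler_norm _) hn.
Qed.

(** A closure under linear operations instead of explicit finite sums: products, bounds and
    projections then follow by induction without handling coefficients. *)
Inductive trig : (R -> C) -> Prop :=
| trig_zn n : trig (zn n)
| trigD p q : trig p -> trig q -> trig (fun t => p t + q t)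
| trigZ c p : trig p -> trig (fun t => c * p t).

Lemma trig_ext p q : trig p -> (forall t, p t = q t) -> trig q.
Proof. by move=> pt /funext <-. Qed.

Lemma trig_cst c : trig (fun=> c).
Proof. by apply: (trig_ext (trigZ c (trig_zn 0))) => t; rewrite zn0 mulr1. Qed.

Lemma trigM p q : trig p -> trig q -> trig (fun t => p t * q t).
Proof.
move=> pt qt; elim: pt => [n|p1 p2 _ h1 _ h2|c p1 _ h1].
- elim: qt => [m|p1 p2 _ h1 _ h2|c p1 _ h1].
  + by apply: (trig_ext (trig_zn (n + m))) => t; rewrite znD.
  + by apply: (trig_ext (trigD h1 h2)) => t; rewrite mulrDr.
  + by apply: (trig_ext (trigZ c h1)) => t; rewrite mulrCA.
- by apply: (trig_ext (trigD h1 h2)) => t; rewrite mulrDl.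
- by apply: (trig_ext (trigZ c h1)) => t; rewrite mulrA.
Qed.

Lemma trigX p n : trig p -> trig (fun t => p t ^+ n).
Proof.
move=> pt; elim: n => [|n ih]; first exact: (trig_cst 1).
by apply: (trig_ext (trigM pt ih)) => t; rewrite exprS.
Qed.

Lemma trig_meas p : trig p -> cmeasurable p.
Proof.
elim=> [n|p1 p2 _ h1 _ h2|c p1 _ h1]; first exact: zn_meas.
  exact: cmeasD.
by apply: cmeasM => //; exact: cmeas_cst.
Qed.

Lemma trig_bounded p : trig p -> ess_bounded p.
Proof.
elim=> [n|p1 p2 _ h1 _ h2|c p1 _ h1]; first exact: zn_bounded.
  exact: ess_boundedD.
by apply: ess_boundedM => //; exact: ess_bounded_cst.
Qed.

Lemma trig_L2 p : trig p -> L2 p.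
Proof. by move=> pt; apply: L2_bounded; [exact: trig_meas|exact: trig_bounded]. Qed.

Lemma trig_cos : trig (fun t => (cos t)%:C).
Proof.
apply: (trig_ext (trigZ (2^-1) (trigD (trig_zn 1) (trig_zn (-1))))) => t.
by rewrite znN /zn mul1r (_ : 2^-1 = (2^-1)%:C :> C) ?fmorphV ?rmorph_nat //; apply: complex_ext; rewrite !creimE /=; field.
Qed.

Lemma trig_sin : trig (fun t => (sin t)%:C).
Proof.
apply: (trig_ext (trigZ (0 -i* 2^-1) (trigD (trig_zn 1) (trigZ (-1) (trig_zn (-1)))))) => t.
by rewrite znN /zn mul1r; apply: complex_ext; rewrite !creimE /=; field.
Qed.

(** The closure of the trigonometric polynomials in L^2; [trig_dense] shows that it is the whole
    space. *)
Definition approximable f := L2 f /\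
  forall e : R, 0 < e -> exists p, trig p /\ sqnorm (fun t => f t - p t) < e.

Lemma approximable_trig p : trig p -> approximable p.
Proof.
move=> pt; split; first exact: trig_L2.
move=> e e0; exists p; split => //; rewrite (_ : (fun t => _) = fun t => 0 * p t).
  rewrite sqnormZ; last exact: trig_L2.
  by rewrite cabs0 expr0n mul0r.
by apply/funext => t; rewrite subrr mul0r.
Qed.

Lemma approximable_lim f : L2 f ->
  (forall e : R, 0 < e -> exists g, approximable g /\ sqnorm (fun t => f t - g t) < e) ->
  approximable f.
Proof.
move=> f2 H; split => // e e0; have e4 : 0 < e / 4 by lra.
have [g [[g2 gcl] fg]] := H _ e4; have [p [pt gp]] := gcl _ e4.
exists p; split => //; have p2 := trig_L2 pt.
have := sqnormD (L2B f2 g2) (L2B g2 p2).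
rewrite (_ : (fun t => f t - g t + (g t - p t)) = (fun t => f t - p t)); first by lra.
by apply/funext => t; ring.
Qed.

Lemma approximableD f g : approximable f -> approximable g -> approximable (fun t => f t + g t).
Proof.
move=> [f2 fc] [g2 gc]; split; first exact: L2D.
move=> e e0; have e4 : 0 < e / 4 by lra.
have [p [pt fp]] := fc _ e4; have [q [qt gq]] := gc _ e4.
exists (fun t => p t + q t); split; first exact: trigD.
have := sqnormD (L2B f2 (trig_L2 pt)) (L2B g2 (trig_L2 qt)).
rewrite (_ : (fun t => f t - p t + (g t - q t)) = (fun t => f t + g t - (p t + q t))); first by lra.
by apply/funext => t; ring.
Qed.

(** Multiplication by a bounded [q] is continuous on L^2, so it is enough to know its effect on
    trigonometric polynomials. *)
Lemma approximableMb q f : cmeasurable q -> ess_bounded q ->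
  (forall p, trig p -> approximable (fun t => q t * p t)) ->
  approximable f -> approximable (fun t => q t * f t).
Proof.
move=> qm [M qM] qc [f2 fc]; apply: approximable_lim.
  by apply: L2Mb => //; exists M.
move=> e e0; have d0 : 0 < e / (M ^+ 2 + 1) by rewrite divr_gt0 // ltr_wpDl ?sqr_ge0.
have [p [pt fp]] := fc _ d0; exists (fun t => q t * p t); split; first exact: qc.
have := sqnorm_bound qm (L2B f2 (trig_L2 pt)) qM.
rewrite (_ : (fun t => q t * (f t - p t)) = (fun t => q t * f t - q t * p t)); last first.
  by apply/funext => t; ring.
move=> h; apply: (le_lt_trans h); have := sqnorm_ge0 (fun t => f t - p t).
move: fp; rewrite ltr_pdivlMr ?ltr_wpDl ?sqr_ge0 //; have := sqr_ge0 M; nra.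
Qed.

Lemma approximableM_trig q f : trig q -> approximable f -> approximable (fun t => q t * f t).
Proof.
move=> qt; apply: approximableMb; [exact: trig_meas|exact: trig_bounded|].
by move=> p pt; apply: approximable_trig; exact: trigM.
Qed.

Lemma approximableM q f : approximable q -> ess_bounded q -> approximable f ->
  approximable (fun t => q t * f t).
Proof.
move=> qc qb; apply: approximableMb => //; first by case: qc => [[]].
move=> p pt; rewrite (_ : (fun t => _) = (fun t => p t * q t)); first exact: approximableM_trig.
by apply/funext => t; rewrite mulrC.
Qed.

Lemma approximableZ c f : approximable f -> approximable (fun t => c * f t).
Proof. by move=> fc; apply: (approximableM_trig (trig_cst c)). Qed.

Lemma approximable_ae f g : cmeasurable g -> aeeq f g -> approximable f -> approximable g.
Proof.
move=> gm fg fc; have f2 : L2 f by case: fc.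
have g2 := L2_ae gm fg f2; apply: approximable_lim => // e e0; exists f; split => //.
have d2 := L2B g2 f2.
have dz : aeeq (fun t => g t - f t) (fun=> 0).
  by apply: (ae_imp _ fg) => t h tc; rewrite h // subrr.
rewrite (sqnorm_ae d2.1 (cmeas_cst 0) dz) sqnormE.
under [X in Rintegral _ _ X]eq_fun do rewrite cabs0 expr0n.
by rewrite Rintegral_cst // !mul0r.
Qed.

Lemma approximable_dct (f_ : nat -> R -> C) f g : cmeasurable f -> L2 g -> (forall n, approximable (f_ n)) ->
  (forall n t, circ t -> cabs (f_ n t) <= cabs (g t)) ->
  (forall t, circ t -> cabs (f t) <= cabs (g t)) ->
  (forall t, circ t -> (fun n => cabs (f t - f_ n t)) @ \oo --> (0 : R)) ->
  approximable f.
Proof.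
move=> fm g2 fc fg fg' ff; have f2 : L2 f.
  by apply: (L2_dom fm g2); exists 1; apply: ae_all => t tc; rewrite mul1r fg'.
apply: approximable_lim => // e e0.
have [| |n hn] := @sqnorm_dct (fun n t => f t - f_ n t) (fun t => 2 * g t) _ (L2Z 2 g2) _ ff e e0.
- by move=> n; case: (L2B f2 (fc n).1).
- move=> n t tc; apply: (le_trans (cabsD _ _)); rewrite cabsN cabsM.
  rewrite (_ : cabs 2 = 2); last by rewrite -(rmorph_nat (real_complex R)) cabs_real normr_nat.
  by have := fg n t tc; have := fg' t tc; lra.
- by exists (f_ n).
Qed.
End Trigonometric.

(** * Density of trigonometric polynomials *)

Section Density.
Variable R : realType.
Local Notation C := R[i].
Local Notation mu := (@lebesgue_measure R).
Local Notation circ := (@circ R).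
Implicit Types (f g h : R -> C) (a c : C).
#[local] Hint Extern 0 (measurable _) => (exact: measurable_circ) : core.

(** * Polynomials converging to a jump at 1/2 *)

Lemma expr1B_bernoulli (x : R) m : 0 <= x <= 1 -> 1 - (1 - x) ^+ m <= m%:R * x.
Proof.
move=> /andP[x0 x1]; elim: m => [|m ih]; first by rewrite expr0 subrr mul0r.
have h : 0 <= (1 - x) ^+ m by rewrite exprn_ge0 // subr_ge0.
have h1 : (1 - x) ^+ m <= 1 by rewrite exprn_ile1 ?subr_ge0 // gerBl.
rewrite exprS -natr1; nra.
Qed.

Lemma expr1B_le_inv (x : R) m : 0 <= x <= 1 -> (1 - x) ^+ m * (1 + m%:R * x) <= 1.
Proof.
move=> /andP[x0 x1]; elim: m => [|m ih]; first by rewrite expr0 mul0r addr0 mulr1.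
have h : 0 <= (1 - x) ^+ m by rewrite exprn_ge0 // subr_ge0.
apply: le_trans ih; rewrite exprS -natr1 (mulrC (1 - x)) -mulrA ler_wpM2l //.
have : 0 <= m%:R * x ^+ 2 by rewrite mulr_ge0 ?sqr_ge0.
by have := sqr_ge0 x; nra.
Qed.

Lemma natr_expr_bound (r : R) n : 0 <= r <= 1 -> n%:R * r ^+ n * (1 - r) <= 1.
Proof.
(* The strengthened form supports the induction: [1 - r^n] is [1 - r] times a geometric sum of [n]
   terms, each at least [r^n]. *)
move=> /andP[r0 r1]; suff : n%:R * r ^+ n * (1 - r) + r ^+ n <= 1.
  by apply: le_trans; rewrite lerDl exprn_ge0.
elim: n => [|n ih]; first by rewrite !mul0r add0r expr0.
have h : 0 <= r ^+ n by rewrite exprn_ge0.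
have h1 : r ^+ n <= 1 by rewrite exprn_ile1.
have a := ler_wpM2l r0 ih.
have b : r * r ^+ n * (1 - r) <= 1 * (1 - r).
  by rewrite ler_wpM2r ?subr_ge0 // mulr_ile1.
by rewrite exprS -natr1; move: a b; set X := r ^+ n; nra.
Qed.

Lemma sqrX01 n (y : R) : 0 <= y <= 1 -> 0 <= (y ^+ 2) ^+ n <= 1.
Proof.
move=> /andP[y0 y1]; have h0 : 0 <= y ^+ 2 by rewrite sqr_ge0.
by rewrite exprn_ge0 //= exprn_ile1 //; nra.
Qed.

(* The exponent [n * 4 ^ n] makes [step n y] converge at every [y] in [0, 1], the
   threshold [y = 1/2] included, to the indicator of [y < 1/2]. *)
Definition step n (y : R) : R := (1 - (y ^+ 2) ^+ n) ^+ (n * 4 ^ n).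

Lemma step_bound n y : 0 <= y <= 1 -> 0 <= step n y <= 1.
Proof.
move=> /andP[y0 y1]; have /andP[h0 h1] : 0 <= (y ^+ 2) ^+ n <= 1 by apply: sqrX01; rewrite y0.
by rewrite exprn_ge0 ?exprn_ile1 //; lra.
Qed.

(** Bernoulli bounds the error by [n * 4^n * y^(2n) = n * r^n * r^n] with [r = 2y < 1]; one factor
    [r^n] absorbs [n] at the cost of [1 / (1 - r)]. *)
Lemma step_lt n y : 0 <= y < 1 / 2 -> `|1 - step n y| <= (1 - 2 * y)^-1 * (2 * y) ^+ n.
Proof.
move=> /andP[y0 y1]; have y01 : 0 <= y <= 1 by lra.
have /andP[s0 s1] := step_bound n y01.
rewrite ger0_norm ?subr_ge0 //.
have h0 := sqrX01 n y01.
apply: (le_trans (expr1B_bernoulli _ h0)).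
have r01 : 0 <= 2 * y <= 1 by lra.
have d0 : 0 < 1 - 2 * y by lra.
rewrite ler_pdivlMl //; have := natr_expr_bound n r01; rewrite natrM natrX.
have e : 4%:R ^+ n * (y ^+ 2) ^+ n = (2 * y) ^+ n * (2 * y) ^+ n.
  by rewrite -!exprMn; congr (_ ^+ _); ring.
rewrite -(mulrA n%:R (4 ^+ n)) e; set X := (2 * y) ^+ n => h; have X0 : 0 <= X by rewrite exprn_ge0; lra.
by move: h X0 d0; move: (1 - 2 * y) => d h X0 d0; nra.
Qed.

(** Here [4^n * y^(2n) >= 1], so [(1 - x)^m <= 1 / (1 + m x)] with [m = n * 4^n] yields
    [1 / (n + 1)], also at the threshold. *)
Lemma step_ge n y : 1 / 2 <= y <= 1 -> `|step n y| <= n.+1%:R^-1.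
Proof.
move=> /andP[y0 y1]; have y01 : 0 <= y <= 1 by lra.
have /andP[s0 s1] := step_bound n y01; rewrite ger0_norm //.
have h0 := sqrX01 n y01.
have := expr1B_le_inv (n * 4 ^ n) h0; rewrite -/(step n y) => h.
have k : n.+1%:R <= 1 + (n * 4 ^ n)%:R * (y ^+ 2) ^+ n :> R.
  rewrite -natr1 addrC lerD2l natrM natrX -mulrA ler_peMr // -exprMn exprn_ege1 //.
  by nra.
rewrite -[_^-1]mul1r ler_pdivlMr ?ltr0n //; apply: le_trans h.
by rewrite ler_wpM2l.
Qed.

Lemma step_cvg (y : R) : 0 <= y <= 1 ->
  (fun n => (y < 1 / 2)%R%:R - step n y) @ \oo --> (0 : R).
Proof.
move=> /andP[y0 y1]; apply/norm_cvg0P.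
have [yl|yl] := ltP y (1 / 2).
- apply: (@squeeze_cvgr _ _ _ _ (cst 0) (fun n => (1 - 2 * y)^-1 * (2 * y) ^+ n)).
  + by apply: nearW => n; rewrite normr_ge0 /= step_lt // y0 yl.
  + exact: cvg_cst.
  + rewrite -[X in _ --> X](mulr0 (1 - 2 * y)^-1); apply: cvgM; first exact: cvg_cst.
    by apply: cvg_expr; rewrite ger0_norm; lra.
- apply: (@squeeze_cvgr _ _ _ _ (cst 0) (fun n => n.+1%:R^-1)).
  + by apply: nearW => n; rewrite normr_ge0 /= sub0r normrN step_ge // yl y1.
  + exact: cvg_cst.
  + exact: cvg_harmonic.
Qed.

Definition ind (A : set R) (t : R) : C := (\1_A t)%:C.

Lemma ind_in A t : A t -> ind A t = 1.
Proof. by move=> At; rewrite /ind indicE mem_set. Qed.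
Lemma ind_out A t : ~ A t -> ind A t = 0.
Proof. by move=> At; rewrite /ind indicE memNset. Qed.
Lemma cabs_ind A t : cabs (ind A t) <= 1.
Proof. by rewrite /ind cabs_real indicE normr_nat lern1 leq_b1. Qed.
Lemma ind_meas (A : set R) : measurable A -> cmeasurable (ind A).
Proof.
move=> mA; split; first by apply: measurable_funTS; exact: measurable_indic.
exact: measurable_cst.
Qed.
Lemma ind_bounded A : ess_bounded (ind A).
Proof. by exists 1; apply: ae_all => t _; exact: cabs_ind. Qed.

(* These sets form a sigma-algebra, since approximable bounded functions form an
   algebra closed under dominated limits. *)
Definition approximable_set (A : set R) := measurable A /\ approximable (ind A).

(** Comparing only on [circ] and up to null sets allows rays to be replaced by level sets of the
    periodic functions [cos] and [sin]. *)
Lemma approximable_set_ae A B : measurable B ->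
  {ae mu, forall t, circ t -> (A t <-> B t)} ->
  approximable_set A -> approximable_set B.
Proof.
move=> mB AB [mA cA]; split => //; apply: (approximable_ae (ind_meas mB) _ cA).
apply: (ae_imp _ AB) => t h tc; have [At|At] := pselect (A t).
  by rewrite !ind_in //; apply/h.
by rewrite !ind_out // => Bt; apply: At; apply/h.
Qed.

Lemma approximable_setC A : approximable_set A -> approximable_set (~` A).
Proof.
move=> [mA cA]; split; first exact: measurableC.
rewrite (_ : ind _ = fun t => 1 + -1 * ind A t).
  by apply: approximableD; [apply: approximable_trig; exact: trig_cst|exact: approximableZ].
apply/funext => t; have [At|At] := pselect (A t).
  by rewrite ind_out ?ind_in ?mulr1 ?subrr // => /(_ At).
by rewrite ind_in ?ind_out ?mulr0 ?addr0.
Qed.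

Lemma approximable_setI A B : approximable_set A -> approximable_set B -> approximable_set (A `&` B).
Proof.
move=> [mA cA] [mB cB]; split; first exact: measurableI.
rewrite (_ : ind _ = fun t => ind A t * ind B t); first by apply: approximableM => //; exact: ind_bounded.
apply/funext => t; have [At|At] := pselect (A t); last first.
  by rewrite (ind_out At) mul0r ind_out // => -[].
by have [Bt|Bt] := pselect (B t);
  [rewrite !ind_in ?mulr1|rewrite (ind_out Bt) mulr0 ind_out // => -[]].
Qed.

Lemma approximable_setU A B : approximable_set A -> approximable_set B -> approximable_set (A `|` B).
Proof.
by move=> cA cB; rewrite -[_ `|` _]setCK setCU; apply/approximable_setC/approximable_setI; exact: approximable_setC.
Qed.

Lemma approximable_set0 : approximable_set set0.
Proof.
split; first exact: measurable0; rewrite (_ : ind _ = fun=> 0); first exact/approximable_trig/trig_cst.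
by apply/funext => t; rewrite ind_out.
Qed.

Lemma approximable_set_bigcup (A : (set R)^nat) : (forall n, approximable_set (A n)) ->
  approximable_set (\bigcup_n A n).
Proof.
move=> cA; pose B n := \big[setU/set0]_(i < n) A i.
have cB n : approximable_set (B n).
  rewrite /B; elim: n => [|n ih]; first by rewrite big_ord0; exact: approximable_set0.
  by rewrite big_ord_recr; exact: approximable_setU.
have mA : measurable (\bigcup_n A n) by apply: bigcup_measurable => n _; case: (cA n).
split => //; apply: (@approximable_dct _ (fun n => ind (B n)) _ (fun=> 1)).
- exact: ind_meas.
- exact: L2_cst.
- by move=> n; case: (cB n).
- by move=> n t _; rewrite cabs1; exact: cabs_ind.
- by move=> t _; rewrite cabs1; exact: cabs_ind.
(* At each point the indicators of the finite unions are eventually constant. *)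
- move=> t _; apply: (cvg_near_cst); have [[n _ Ant]|nA] := pselect ((\bigcup_n A n) t).
    exists n.+1 => // m nm; rewrite ind_in ?ind_in ?subrr ?cabs0 //; last by exists n.
    by rewrite /B -bigcup_mkord; exists n.
  apply: nearW => m; rewrite !ind_out ?subrr ?cabs0 // /B -bigcup_mkord => -[k _ Ak].
  by apply: nA; exists k.
Qed.

(** Since [step n] is a polynomial, [step n (y t)] is a trigonometric polynomial in [t]; these are
    bounded by 1 and converge pointwise to the indicator. *)
Lemma approximable_set_lt (y : R -> R) : measurable_fun setT y -> trig (fun t => (y t)%:C) ->
  (forall t, 0 <= y t <= 1) -> approximable_set [set t | y t < 1 / 2].
Proof.
move=> my yt y01; have mS : measurable [set t | y t < 1 / 2].
  rewrite (_ : [set _ | _] = setT `&` y @^-1` `]-oo, (1 / 2)[%classic); first exact: my.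
  by rewrite setTI; apply/seteqP; split => t /=; rewrite in_itv.
split => //; apply: (@approximable_dct _ (fun n t => (step n (y t))%:C) _ (fun=> 1)).
- exact: ind_meas.
- exact: L2_cst.
- move=> n; apply: approximable_trig; rewrite /step.
  apply: (@trig_ext _ (fun t => (1 + -1 * (((y t)%:C) ^+ 2) ^+ n) ^+ (n * 4 ^ n))).
    by apply/trigX/trigD; [exact: trig_cst|apply/trigZ/trigX/trigX].
  by move=> t; rewrite mulN1r !(rmorphXn, rmorphB, rmorph1).
- move=> n t _; rewrite cabs1 cabs_real; have /andP[h0 h1] := step_bound n (y01 t).
  by rewrite ger0_norm.
- by move=> t _; rewrite cabs1; exact: cabs_ind.
- move=> t _; have /cvg_norm := step_cvg (y01 t); rewrite normr0.
  apply: cvg_trans; apply: near_eq_cvg; apply: nearW => n.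
  have -> : ind [set t | y t < 1 / 2] t = ((y t < 1 / 2)%R%:R)%:C.
    by rewrite /ind indicE; congr (_%:R)%:C; congr nat_of_bool;
    apply/idP/idP => [/set_mem|h]; last exact/mem_set.
  by rewrite -(rmorphB (real_complex R)) cabs_real.
Qed.

Lemma measurable_cos : measurable_fun setT (@cos R).
Proof. by apply: continuous_measurable_fun; exact: continuous_cos. Qed.
Lemma measurable_sin : measurable_fun setT (@sin R).
Proof. by apply: continuous_measurable_fun; exact: continuous_sin. Qed.

(** The sign [s] selects the side of the threshold [c]. As [s * (u - c)] lies in [-2, 2], dividing
    by 4 and adding 1/2 brings it into [0, 1] with the threshold at 1/2. *)
Lemma approximable_set_affine (u : R -> R) (s c : R) : measurable_fun setT u -> trig (fun t => (u t)%:C) ->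
  (forall t, `|u t| <= 1) -> `|s| = 1 -> `|c| <= 1 -> approximable_set [set t | s * u t < s * c].
Proof.
move=> mu_ ut u1 s1 c1.
rewrite (_ : [set _ | _] = [set t | 1 / 2 + s * (u t - c) / 4 < 1 / 2]); last first.
  by apply/seteqP; split => t /=; nra.
apply: approximable_set_lt.
- apply: measurable_funD; first exact: measurable_cst.
  apply: measurable_funM; last exact: measurable_cst.
  apply: measurable_funM; first exact: measurable_cst.
  by apply: measurable_funB => //; exact: measurable_cst.
- apply: (@trig_ext _ (fun t => (1 / 2 - s * c / 4)%:C + (s / 4)%:C * (u t)%:C)).
    by apply: trigD; [exact: trig_cst|exact: trigZ].
  by move=> t; rewrite -rmorphM -rmorphD; congr _%:C; field.
- move=> t; have : `|s * (u t - c)| <= 2.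
    by rewrite normrM s1 mul1r (le_trans (ler_normB _ _)) //; have := u1 t; lra.
  by rewrite ler_norml => /andP[h1 h2]; apply/andP; split; lra.
Qed.

Lemma ae_neq (a : R) : {ae mu, forall t, t != a}.
Proof.
exists [set a]; split; [exact: measurable_set1|exact: lebesgue_measure_set1|].
by move=> t /= /negP; rewrite negbK => /eqP.
Qed.

(** The cosine is injective on each half of the circle and the sign of the sine tells the halves
    apart. For [0 <= a < pi], [t > a] means [cos t < cos a] or [sin t < 0]; for [pi <= a < 2 pi] it
    means [cos t > cos a] and [sin t < 0]. The point [2 pi], where the sine vanishes, is discarded
    as a null set. *)
Lemma approximable_set_ray (a : R) : approximable_set `]a, +oo[.
Proof.
have mr : measurable `]a, +oo[ by exact: measurable_itv.
have pi0 := pi_gt0 R.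
have sinN : approximable_set [set t | sin t < 0 :> R].
  have := @approximable_set_affine sin 1 0 measurable_sin (trig_sin R) (@sin_max R) (normr1 _).
  rewrite normr0 ler01 => /(_ isT); congr approximable_set.
  by apply/seteqP; split => t /=; rewrite !mul1r.
have cosP s : `|s| = 1 -> approximable_set [set t | s * cos t < s * cos a].
  by move=> s1; exact: (approximable_set_affine measurable_cos (trig_cos R) (@cos_max R) s1 (cos_max a)).
have sin_lt0 (t : R) : pi < t < 2 * pi -> sin t < 0.
  move=> tp; rewrite -[t](subrK pi) sinDpi oppr_lt0; apply: sin_gt0_pi; lra.
have cosR (t : R) : cos (2 * pi - t) = cos t.
  by rewrite cosB (_ : 2 * pi = pi *+ 2) ?cos2pi ?sin2pi ?mul1r ?mul0r ?addr0 // mulr2n; ring.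
have [al|al] := ltP a 0.
  apply: (approximable_set_ae mr _ (approximable_setC approximable_set0)).
  apply: ae_all => t; rewrite /circ /= !in_itv /= => /andP[t0 t1].
  by split => // _; lra.
have [ar|ar] := leP (2 * pi) a.
  apply: (approximable_set_ae mr _ approximable_set0).
  apply: ae_all => t; rewrite /circ /= !in_itv /= andbT => /andP[t0 t1].
  by split => //; lra.
have [am|am] := ltP a pi.
  apply: (@approximable_set_ae ([set t | 1 * cos t < 1 * cos a] `|` [set t | sin t < 0])) => //; last first.
    by apply: approximable_setU => //; apply: cosP; rewrite normr1.
  apply: (ae_imp _ (ae_neq (2 * pi))) => t /eqP t2; rewrite /circ /= !in_itv /= andbT !mul1r => /andP[t0 t1].
  have [tp|tp] := leP t pi.
    have s0 : 0 <= sin t by apply: sin_ge0_pi; rewrite t0.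
    rewrite ltr_cos ?in_itv /= ?t0 ?tp ?al ?(ltW am) //.
    by split => [[//|]|]; [lra|left].
  have s0 : sin t < 0 by apply: sin_lt0; rewrite tp lt_neqAle t1 andbT; apply/eqP.
  by split => _; [lra|right].
apply: (@approximable_set_ae ([set t | -1 * cos t < -1 * cos a] `&` [set t | sin t < 0])) => //; last first.
  by apply: approximable_setI => //; apply: cosP; rewrite normrN1.
apply: (ae_imp _ (ae_neq (2 * pi))) => t /eqP t2; rewrite /circ /= !in_itv /= andbT !mulN1r ltrN2 => /andP[t0 t1].
have [tp|tp] := leP t pi.
  have s0 : 0 <= sin t by apply: sin_ge0_pi; rewrite t0.
  by split => [[_]|]; lra.
have s0 : sin t < 0 by apply: sin_lt0; rewrite tp lt_neqAle t1 andbT; apply/eqP.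
rewrite -(cosR t) -(cosR a) ltr_cos ?in_itv /=; [|by apply/andP; split; lra..].
by split => [[h _]|h]; [lra|split => //; lra].
Qed.

Lemma measurable_approximable_set (A : set R) : measurable A -> approximable_set A.
Proof.
have -> : measurable A = (RGenOInfty.G (R := R)).-sigma.-measurable A.
  by rewrite -RGenOInfty.measurableE.
apply: smallest_sub; last by move=> _ [x ->]; exact: approximable_set_ray.
split; [exact: approximable_set0| |exact: approximable_set_bigcup].
by move=> B; rewrite setTD; exact: approximable_setC.
Qed.

Lemma approximable_sum n (F : 'I_n -> R -> C) : (forall i, approximable (F i)) ->
  approximable (fun t => \sum_(i < n) F i t).
Proof.
elim: n F => [|n ih] F cF.
  by under eq_fun do rewrite big_ord0; exact/approximable_trig/trig_cst.
by under eq_fun do rewrite big_ord_recr /=; apply: approximableD => //; exact: ih.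
Qed.

Import HBNNSimple.

Lemma approximable_nnsfun (g : {nnsfun R >-> R}) : approximable (fun t : R => (g t)%:C).
Proof.
rewrite (_ : (fun t => _) = fun t => \sum_(i < #|` fset_set (g @` setT)|)
    ((fset_set (g @` setT))`_i)%:C * ind (g @^-1` [set (fset_set (g @` setT))`_i]) t); last first.
  apply/funext => t; rewrite fimfunEord rmorph_sum /=; apply: eq_bigr => i _.
  exact: (rmorphM (real_complex R)).
apply: approximable_sum => i; apply: approximableZ; apply: (measurable_approximable_set _).2.
by rewrite -[_ @^-1` _]setTI; apply: measurable_funPT => //; exact: measurable_set1.
Qed.

Lemma approximable_nonneg (f : R -> R) : L2 (fun t => (f t)%:C) -> (forall t, 0 <= f t) ->
  approximable (fun t => (f t)%:C).
Proof.
move=> f2 f0; have [[mf _] _] := f2.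
have mf' : measurable_fun circ (EFin \o f) by exact/measurable_EFinP.
pose g n : {nnsfun R >-> R} := nnsfun_approx (@measurable_circ R) mf' n.
have f0' t : circ t -> (0 <= (EFin \o f) t)%E by rewrite lee_fin.
have gf t : circ t -> (fun n => g n t) @ \oo --> f t.
  move=> tc; have /fine_cvg := @cvg_nnsfun_approx _ _ _ _ (@measurable_circ R) _ mf' f0' t tc.
  exact.
have gle n t : circ t -> g n t <= f t.
  move=> tc; rewrite -lee_fin /g nnsfun_approxE.
  exact: (@le_approx _ _ _ _ _ n t f0' tc).
apply: (@approximable_dct _ (fun n t => (g n t)%:C) _ (fun t => (f t)%:C)) => //.
- by move=> n; exact: approximable_nnsfun.
- by move=> n t tc; rewrite !cabs_real !ger0_norm //; exact: gle.
- move=> t tc; have /cvg_norm : (fun n => f t - g n t) @ \oo --> (0 : R).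
    by rewrite -[X in _ --> X](subrr (f t)); apply: cvgB; [exact: cvg_cst|exact: gf].
  rewrite normr0; apply: cvg_trans; apply: near_eq_cvg; apply: nearW => n.
  by rewrite -(rmorphB (real_complex R)) cabs_real.
Qed.

Lemma trig_dense f : L2 f -> approximable f.
Proof.
move=> f2; have re2 : L2 (fun t => (cre (f t))%:C).
  apply: (L2_dom _ f2); first by case: (f2.1) => m1 m2; split => //; exact: measurable_cst.
  exists 1; apply: ae_all => t _; rewrite mul1r cabs_real -(@ler_pXn2r _ 2) ?nnegrE ?cabs_ge0 //.
  by rewrite cabs2E real_normK ?num_real // lerDl sqr_ge0.
have im2 : L2 (fun t => (cim (f t))%:C).
  apply: (L2_dom _ f2); first by case: (f2.1) => m1 m2; split => //; exact: measurable_cst.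
  exists 1; apply: ae_all => t _; rewrite mul1r cabs_real -(@ler_pXn2r _ 2) ?nnegrE ?cabs_ge0 //.
  by rewrite cabs2E real_normK ?num_real // lerDr sqr_ge0.
have key (u : R -> R) : L2 (fun t => (u t)%:C) -> approximable (fun t => (u t)%:C).
  move=> u2; have [[mu_ _] _] := u2.
  have p2 : L2 (fun t => (Num.max (u t) 0)%:C).
    apply: (L2_dom _ u2); first by split; [apply: measurable_maxr => //|]; exact: measurable_cst.
    exists 1; apply: ae_all => t _; rewrite mul1r !cabs_real; case: (lerP (u t) 0) => h.
      by rewrite normr0.
    by [].
  have n2 : L2 (fun t => (Num.max (u t) 0 - u t)%:C).
    rewrite (_ : (fun t => _) = (fun t => (Num.max (u t) 0)%:C - (u t)%:C)); first exact: L2B.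
    by apply/funext => t; rewrite rmorphB.
  (* Positive part minus negative part, the latter written as [max u 0 - u]. *)
  rewrite (_ : (fun t => _) = (fun t => (Num.max (u t) 0)%:C + -1 * (Num.max (u t) 0 - u t)%:C)).
    apply: approximableD; last apply: approximableZ.
    - by apply: approximable_nonneg => // t; rewrite le_max lexx orbT.
    - by apply: approximable_nonneg => // t; rewrite subr_ge0 le_max lexx.
  by apply/funext => t; rewrite mulN1r -rmorphN -rmorphD; congr _%:C; ring.
rewrite (_ : f = fun t => (cre (f t))%:C + (0 +i* 1) * (cim (f t))%:C).
  by apply: approximableD; [exact: key|apply: approximableZ; exact: key].
by apply/funext => t; apply: complex_ext; rewrite !creimE /=; ring.
Qed.

End Density.

(** * Hardy space *)

Section Hardy.
Variable R : realType.
Local Notation C := R[i].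
Local Notation mu := (@lebesgue_measure R).
Local Notation circ := (@circ R).
Local Notation ip := (@cinner R).
Implicit Types (f g h : R -> C) (a c : C).
Ltac solve_L2 := repeat first [assumption | exact: L2_cst | exact: zn_L2 | apply: L2B
  | apply: L2D | apply: L2N | apply: L2Z ].
#[local] Hint Extern 0 (L2 _) => solve [solve_L2] : core.
#[local] Hint Extern 0 (measurable _) => (exact: measurable_circ) : core.

Lemma zn0E : zn 0 = (fun=> 1) :> (R -> C).
Proof. by apply/funext => t; exact: zn0. Qed.

Lemma ipM q f h : ip (fun t => q t * f t) h = ip f (fun t => (q t)^* * h t).
Proof. by congr cmean; apply/funext => t /=; rewrite cconjM cconjK mulrA (mulrC (q t)). Qed.

Lemma ip_zn n f h : ip (fun t => zn n t * f t) h = ip f (fun t => zn (- n) t * h t).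
Proof. by rewrite ipM; congr cinner; apply/funext => t; rewrite znN. Qed.

Lemma zn_zn m n : (fun t => zn m t * zn n t) = zn (m + n) :> (R -> C).
Proof. by apply/funext => t; rewrite znD. Qed.

Lemma expi_2pi (n : int) : expi (n%:~R * (2 * pi)) = 1 :> C.
Proof.
have e (k : nat) : expi (k%:R * (2 * pi)) = 1 :> C.
  elim: k => [|k ih]; first by rewrite mul0r expi0.
  rewrite -natr1 mulrDl mul1r expiD ih mul1r mulr_natl.
  by apply: complex_ext; rewrite /= ?cos2pi ?sin2pi.
case: n => k; first exact: e.
by rewrite NegzE rmorphN /= mulNr expiN (e k.+1) cconj1.
Qed.

(** Both parts have a primitive of the form [n^-1 * F (n t)], whose values at 0 and [2 pi] agree by
    [expi_2pi]. *)
Lemma cint_zn (n : int) : n != 0 -> cint (zn n) = 0 :> C.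
Proof.
move=> n0; have N0 : n%:~R != 0 :> R by rewrite intr_eq0.
have two_pi := twopi_gt0 R.
have := expi_2pi n; move=> /[dup] /(congr1 (@cre R)) /= c2 /(congr1 (@cim R)) /= s2.
have cc (f : R -> R) : continuous f -> {within `[0, 2 * pi], continuous (fun t : R => f (n%:~R * t))}.
  move=> cf; apply: continuous_subspaceT => x; apply: continuous_comp; last exact: cf.
  by apply: cvgM; [exact: cvg_cst|exact: cvg_id].
have dd (F f : R -> R) : (forall x : R, is_derive x (1 : R) F (f x)) ->
    forall x : R, is_derive x (1 : R) (fun t : R => (n%:~R)^-1 * F (n%:~R * t)) (f (n%:~R * x)).
  move=> Ff x.
  have d1 : is_derive x (1 : R) (fun t : R => n%:~R * t) (n%:~R : R).
    apply: (is_derive_eq (@is_deriveZ R R^o R^o (@id R) n%:~R x 1 1 _)).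
    exact: mulr1.
  have d2 := is_derive1_comp (Ff (n%:~R * x)) d1.
  apply: (is_derive_eq (@is_deriveZ R R^o R^o _ (n%:~R)^-1 x 1 _ d2)).
  by rewrite /GRing.scale /= mulrC -mulrA mulfV ?mulr1.
have ftc (F f : R -> R) : continuous f -> (forall x : R, is_derive x (1 : R) F (f x)) ->
    Rintegral mu circ (fun t => f (n%:~R * t)) = (n%:~R)^-1 * (F (n%:~R * (2 * pi)) - F 0).
  move=> cf Ff; have D := dd F f Ff.
  rewrite /Rintegral (@continuous_FTC2 _ _ (fun t : R => (n%:~R)^-1 * F (n%:~R * t)) 0 (2 * pi)) //.
  - by rewrite /= mulr0 mulrBr.
  - exact: cc.
  - have cF : continuous (fun t : R => (n%:~R)^-1 * F (n%:~R * t) : R).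
      by move=> x; apply: differentiable_continuous; apply/derivable1_diffP; case: (D x).
    split.
    + by move=> x _; case: (D x).
    + by apply: cvg_at_right_filter; exact: cF.
    + by apply: cvg_at_left_filter; exact: cF.
  - by move=> x _; rewrite derive1E; case: (D x).
apply: complex_ext => /=.
- rewrite (ftc sin cos) ?s2 ?sin0 ?subrr ?mulr0 //; exact: continuous_cos.
- have dN (x : R) : is_derive x (1 : R) (fun x : R => - cos x) (sin x).
    apply: (is_derive_eq (@is_deriveN R R^o R^o _ x 1 _ (is_derive_cos x))).
    by rewrite opprK.
  by rewrite (ftc _ _ (@continuous_sin R) dN) c2 cos0 subrr mulr0.
Qed.

Lemma ip_zn_zn m n : ip (zn m) (zn n) = (m == n)%:R :> C.
Proof.
rewrite -[zn m](_ : (fun t => zn m t * zn 0 t) = _); last by rewrite zn_zn addr0.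
rewrite ip_zn zn_zn zn0E.
have [->|mn] := eqVneq m n.
  rewrite addNr zn0E cinner_self sqnormE.
  under [X in Rintegral _ _ X]eq_fun do rewrite cabs1 expr1n.
  rewrite Rintegral_cst // [X in fine X]mu_circ /= mul1r divff //.
  by rewrite gt_eqF // twopi_gt0.
rewrite cinnerC; [|exact: zn_L2|exact: L2_cst].
rewrite /cinner; under eq_fun do rewrite cconj1 mulr1.
rewrite cint_zn ?mul0r ?cconj0 //.
by apply: contraNneq mn => e; rewrite -(addr0 m) -e addrA subrr add0r.
Qed.

(** The closing step of the density arguments: Cauchy-Schwarz supplies the bound, with [e] the
    squared distance to an approximant. *)
Lemma approx_eq0 (x : C) (M : R) : 0 <= M ->
  (forall e : R, 0 < e -> cabs x ^+ 2 <= M * e) -> x = 0.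
Proof.
move=> M0 H; apply: cabs0_eq0; apply/eqP; rewrite -sqrf_eq0 eq_le sqr_ge0 andbT.
rewrite leNgt; apply/negP => x0; have M1 : 0 < M + 1 by lra.
have e0 : 0 < cabs x ^+ 2 / (2 * (M + 1)) by rewrite divr_gt0 // mulr_gt0.
have := H _ e0; rewrite mulrA ler_pdivlMr ?mulr_gt0 //; nra.
Qed.

Lemma H2P f : H2 f <-> L2 f /\ forall n : int, n < 0 -> ip f (zn n) = 0.
Proof. by split=> -[f2 h]; split=> // n n0; have := h n n0; rewrite fourierE. Qed.

Lemma value_at_0E f : value_at_0 f = ip f (fun=> 1).
Proof. by rewrite /value_at_0 fourierE zn0E. Qed.

Lemma H2_L2 f : H2 f -> L2 f. Proof. by case. Qed.

Lemma H2D f g : H2 f -> H2 g -> H2 (fun t => f t + g t).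
Proof.
move=> /H2P[f2 fh] /H2P[g2 gh]; apply/H2P; split; first exact: L2D.
by move=> n n0; rewrite cinnerDl ?fh ?gh ?addr0 //; exact: zn_L2.
Qed.
Lemma H2Z c f : H2 f -> H2 (fun t => c * f t).
Proof.
move=> /H2P[f2 fh]; apply/H2P; split; first exact: L2Z.
by move=> n n0; rewrite cinnerZl ?fh ?mulr0 //; exact: zn_L2.
Qed.
Lemma H2_zn (n : int) : 0 <= n -> H2 (zn n : R -> C).
Proof.
move=> n0; apply/H2P; split; first exact: zn_L2.
by move=> m m0; rewrite ip_zn_zn; case: eqP => // nm; lia.
Qed.
Lemma H2_cst c : H2 (fun=> c).
Proof.
have := H2Z c (@H2_zn 0 _); rewrite zn0E; under eq_fun do rewrite mulr1.
exact.
Qed.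

Inductive apoly : (R -> C) -> Prop :=
| apoly_zn (n : nat) : apoly (zn n)
| apolyD p q : apoly p -> apoly q -> apoly (fun t => p t + q t)
| apolyZ c p : apoly p -> apoly (fun t => c * p t).

Lemma apoly_H2 p : apoly p -> H2 p.
Proof. by elim=> [n|*|*]; [exact: H2_zn|exact: H2D|exact: H2Z]. Qed.

Lemma apoly_bounded p : apoly p -> ess_bounded p.
Proof.
elim=> [n|p1 p2 _ h1 _ h2|c p1 _ h1]; first exact: zn_bounded.
  exact: ess_boundedD.
by apply: ess_boundedM => //; exact: ess_bounded_cst.
Qed.

Lemma apoly_proj (p : R -> C) : trig p ->
  exists a : R -> C, apoly a /\ forall h, H2 h -> ip (fun t => p t - a t) h = 0.
Proof.
elim=> [n|p1 p2 t1 [a1 [ap1 h1]] t2 [a2 [ap2 h2]]|c p1 t1 [a1 [ap1 h1]]].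
- have [n0|n0] := leP 0 n.
    exists (zn n); split; first by case: n n0 => // n _; exact: apoly_zn.
    move=> h hh; rewrite (_ : (fun t => _) = fun t => 0 * zn n t).
      by rewrite cinnerZl ?mul0r //; exact: H2_L2.
    by apply/funext => t; rewrite mul0r subrr.
  (* A negative frequency is orthogonal to H^2, so its projection is 0, here in a form that [apoly]
     generates. *)
  exists (fun t => 0 * zn 0 t); split; first by apply: apolyZ; exact: (apoly_zn 0).
  move=> h /H2P [h2 hh]; rewrite (_ : (fun t => _) = zn n).
    by rewrite cinnerC ?hh ?cconj0 //; exact: zn_L2.
  by apply/funext => t; rewrite mul0r subr0.
- exists (fun t => a1 t + a2 t); split; first exact: apolyD.
  move=> h hh; have h2' := H2_L2 hh.
  rewrite (_ : (fun t => _) = fun t => (p1 t - a1 t) + (p2 t - a2 t)).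
    rewrite cinnerDl ?h1 ?h2 ?addr0 //; apply: L2B; try exact: trig_L2; exact/H2_L2/apoly_H2.
  by apply/funext => t; ring.
- exists (fun t => c * a1 t); split; first exact: apolyZ.
  move=> h hh; have h2' := H2_L2 hh.
  rewrite (_ : (fun t => _) = fun t => c * (p1 t - a1 t)).
    rewrite cinnerZl ?h1 ?mulr0 //; apply: L2B; [exact: trig_L2|exact/H2_L2/apoly_H2].
  by apply/funext => t; ring.
Qed.

Lemma sqnormB f g : L2 f -> L2 g ->
  sqnorm (fun t => f t - g t) = sqnorm f + sqnorm g - 2 * cre (ip f g).
Proof.
move=> f2 g2; rewrite /sqnorm cinnerBl // cinnerBr // cinnerBr // (cinnerC f2 g2) !creimE; ring.
Qed.

Lemma sqnorm_le_orth f q (p : R -> C) : L2 f -> L2 q -> L2 p ->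
  ip (fun t => p t - q t) (fun t => f t - q t) = 0 ->
  sqnorm (fun t => f t - q t) <= sqnorm (fun t => f t - p t).
Proof.
move=> f2 q2 p2 o; have fq := L2B f2 q2; have pq := L2B p2 q2.
rewrite (_ : (fun t => f t - p t) = fun t => (f t - q t) - (p t - q t)).
  rewrite [X in _ <= X](sqnormB fq pq) (cinnerC pq fq) o cconj0 mulr0 subr0.
  by rewrite lerDl sqnorm_ge0.
by apply/funext => t; ring.
Qed.

(** Dropping the negative frequencies of an approximating trigonometric polynomial projects it onto
    H^2, which can only bring it closer to [h]. *)
Lemma apoly_dense h (e : R) : H2 h -> 0 < e -> exists a : R -> C, apoly a /\ sqnorm (fun t => h t - a t) < e.
Proof.
move=> hh e0; have [_ /(_ e e0) [p [pt hp]]] := trig_dense (H2_L2 hh).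
have [a [aa ao]] := apoly_proj pt; exists a; split => //.
apply: le_lt_trans hp; apply: sqnorm_le_orth; [exact: H2_L2|exact/H2_L2/apoly_H2|exact: trig_L2|].
apply: ao; have := H2D hh (H2Z (-1) (apoly_H2 aa)).
by under eq_fun do rewrite mulN1r.
Qed.

Lemma orth_H2 f h : L2 f -> (forall n : int, 0 <= n -> ip f (zn n) = 0) -> H2 h -> ip f h = 0.
Proof.
move=> f2 fn hh; apply: (approx_eq0 (sqnorm_ge0 f)) => e e0.
have [a [aa ha]] := apoly_dense hh e0; have h2 := H2_L2 hh; have a2 := H2_L2 (apoly_H2 aa).
have fa : ip f a = 0.
  elim: aa {ha a2} => [n|p q ap hp aq hq|c p ap hp]; first exact: fn.
    by rewrite cinnerDr ?hp ?hq ?addr0 //; exact/H2_L2/apoly_H2.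
  by rewrite cinnerZr ?hp ?mulr0 //; exact/H2_L2/apoly_H2.
have -> : ip f h = ip f (fun t => h t - a t) by rewrite cinnerBr // fa subr0.
apply: (le_trans (cauchy_schwarz f2 (L2B h2 a2))).
by rewrite ler_wpM2l ?sqnorm_ge0 // ltW.
Qed.

(* The backward shift [S*]. *)
Definition bshift f : R -> C := fun t => (zn (-1) t) * (f t - value_at_0 f).

Lemma bshift_L2 f : L2 f -> L2 (bshift f).
Proof.
move=> f2; apply: L2Mb; [exact: zn_meas|exact: zn_bounded|].
by apply: L2B => //; exact: L2_cst.
Qed.

Lemma ip_bshift f h : ip (bshift f) h = ip (fun t => f t - value_at_0 f) (fun t => zn 1 t * h t).
Proof. by rewrite ip_zn opprK. Qed.

Lemma ip_cstl c h : L2 h -> ip (fun=> c) h = c * (value_at_0 h)^*.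
Proof.
move=> h2; rewrite value_at_0E -(cinnerC h2 (L2_cst 1)) -cinnerZl //.
by rewrite (_ : (fun=> c) = fun t => c * 1) //; apply/funext => t; rewrite mulr1.
Qed.

Lemma H2_bshift f : H2 f -> H2 (bshift f).
Proof.
move=> /H2P[f2 fh]; apply/H2P; split; first exact: bshift_L2.
move=> n n0; rewrite ip_bshift zn_zn cinnerBl  //.
rewrite ip_cstl // !value_at_0E -zn0E ip_zn_zn.
have [n1|n1] := eqVneq (1 + n) 0; first by rewrite n1 cconj1 mulr1 subrr.
by rewrite fh ?cconj0 ?mulr0 ?subr0 //; lia.
Qed.

Lemma sqnorm_zn n f : sqnorm (fun t => zn n t * f t) = sqnorm f.
Proof.
by rewrite /sqnorm; congr cre; congr cmean; apply/funext => t; rewrite cconjM mulrACA znJ mul1r.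
Qed.

(** Removing the mean is an orthogonal projection, and multiplication by [conj z] is isometric. *)
Lemma sqnorm_bshift_le f : L2 f -> sqnorm (bshift f) <= sqnorm f.
Proof.
move=> f2; rewrite /bshift sqnorm_zn.
rewrite sqnormB // (cinnerC (L2_cst _) f2) ip_cstl // cconjM cconjK.
rewrite (_ : sqnorm (fun=> value_at_0 f) = cabs (value_at_0 f) ^+ 2).
  rewrite cabs2E !creimE; have := sqr_ge0 (cre (value_at_0 f)).
  by have := sqr_ge0 (cim (value_at_0 f)); nra.
rewrite /sqnorm; move: (value_at_0 f) => v; rewrite ip_cstl // value_at_0E ip_cstl // value_at_0E -zn0E ip_zn_zn eqxx cconj1 mulr1.
by rewrite mulcJ.
Qed.

Lemma bshift_lin c f g : L2 f -> L2 g ->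
  bshift (fun t => c * f t + g t) = fun t => c * bshift f t + bshift g t.
Proof.
move=> f2 g2; apply/funext => t; rewrite /bshift !value_at_0E cinnerDl // cinnerZl //.
by ring.
Qed.

Lemma iter_bshift_L2 n f : L2 f -> L2 (iter n bshift f).
Proof. by move=> f2; elim: n => //= n ih; exact: bshift_L2. Qed.

Lemma iter_bshift_lin n c f g : L2 f -> L2 g ->
  iter n bshift (fun t => c * f t + g t) = fun t => c * iter n bshift f t + iter n bshift g t.
Proof.
by move=> f2 g2; elim: n => //= n ->; rewrite bshift_lin //; exact: iter_bshift_L2.
Qed.

Lemma iter_bshift_sqnorm n f : L2 f -> sqnorm (iter n bshift f) <= sqnorm f.
Proof.
move=> f2; elim: n => //= n ih; apply: le_trans ih; apply: sqnorm_bshift_le; exact: iter_bshift_L2.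
Qed.

Lemma bshift0 : bshift (fun=> 0) = fun=> 0.
Proof. by apply/funext => t; rewrite /bshift value_at_0E ip_cstl ?mul0r ?subr0 ?mulr0 //; exact: L2_cst. Qed.

Lemma iter_bshift0 n : iter n bshift (fun=> 0) = fun=> 0.
Proof. by elim: n => //= n ->; exact: bshift0. Qed.

Lemma bshift_zn (n : nat) : bshift (zn n.+1) = zn n.
Proof.
apply/funext => t; rewrite /bshift value_at_0E -zn0E ip_zn_zn subr0 -znD; congr zn; lia.
Qed.

(** Each shift lowers the degree by one. Asking for all [n >= N] lets the bounds of two summands be
    merged by a maximum. *)
Lemma apoly_nilpotent p : apoly p -> exists N, forall n, (N <= n)%N -> iter n bshift p = fun=> 0.
Proof.
elim=> [k|p1 q1 h1 [N1 H1] h2 [N2' H2']|c p1 h1 [N1 H1]].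
- exists k.+1 => n kn; rewrite -(subnK kn) iterD.
  rewrite (_ : iter k.+1 bshift (zn k) = fun=> 0) ?iter_bshift0 //.
  elim: k {kn} => [|k ih]; last by rewrite iterSr bshift_zn ih.
  by apply/funext => t; rewrite /= /bshift value_at_0E -zn0E ip_zn_zn zn0 subrr mulr0.
- exists (maxn N1 N2') => n; rewrite geq_max => /andP[n1 n2].
  have -> : (fun t => p1 t + q1 t) = fun t => 1 * p1 t + q1 t by apply/funext => t; rewrite mul1r.
  rewrite iter_bshift_lin ?H1 ?H2' //; try exact/H2_L2/apoly_H2.
  by apply/funext => t; rewrite mulr0 addr0.
- exists N1 => n n1.
  have -> : (fun t => c * p1 t) = fun t => c * p1 t + 0 by apply/funext => t; rewrite addr0.
  rewrite iter_bshift_lin ?H1 ?iter_bshift0 //; try exact/H2_L2/apoly_H2; try exact: L2_cst.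
  by apply/funext => t; rewrite mulr0 addr0.
Qed.

(** Once the iterate kills a nearby polynomial [a], only the contracted remainder [f - a] is
    left. *)
Lemma iter_bshift_small f (e : R) : H2 f -> 0 < e -> exists n, sqnorm (iter n bshift f) < e.
Proof.
move=> fh e0; have [a [aa fa]] := apoly_dense fh e0; have [N HN] := apoly_nilpotent aa.
have f2 := H2_L2 fh; have a2 := H2_L2 (apoly_H2 aa).
exists N; apply: le_lt_trans fa.
have -> : f = fun t => 1 * a t + (f t - a t) by apply/funext => t; ring.
rewrite iter_bshift_lin //.
rewrite HN //; under eq_fun do rewrite mulr0 add0r.
under [X in _ <= sqnorm X]eq_fun do rewrite mul1r addrAC subrr add0r.
by apply: iter_bshift_sqnorm; exact: L2B.
Qed.

End Hardy.

(** * Model spaces and truncated Toeplitz operators *)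

Section ModelSpace.
Variable R : realType.
Local Notation C := R[i].
Local Notation mu := (@lebesgue_measure R).
Local Notation circ := (@circ R).
Local Notation ip := (@cinner R).
Local Notation one := (fun=> 1 : R[i]).
Implicit Types (f g h k l : R -> C) (a c : C).
Variable th : R -> C.
Hypothesis th_inner : inner_fun th.
Hypothesis th_0 : value_at_0 th = 0.
Local Notation K := (model_space th).

Lemma th_H2 : H2 th. Proof. by case: th_inner => [[]]. Qed.
Lemma th_L2 : L2 th. Proof. by case: th_H2. Qed.
Lemma th_meas : cmeasurable th. Proof. by case: th_L2. Qed.
Lemma th_bounded : ess_bounded th. Proof. by case: th_inner => [[]]. Qed.
Lemma thJ : {ae mu, forall t, circ t -> th t * (th t)^* = 1}.
Proof.
by case: th_inner => _; apply: ae_imp => t h tc; rewrite mulcJ h // expr1n.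
Qed.

Lemma L2_th f : L2 f -> L2 (fun t => th t * f t).
Proof. exact: L2Mb th_meas th_bounded. Qed.
Lemma L2_znM n f : L2 f -> L2 (fun t => zn n t * f t).
Proof. exact: L2Mb (zn_meas _ _) (zn_bounded _ _). Qed.
Lemma K_H2 f : K f -> H2 f. Proof. by case. Qed.
Lemma K_L2 f : K f -> L2 f. Proof. by case=> /H2_L2. Qed.

Ltac solve_L2 :=
  let go := (idtac; solve_L2) in
  lazymatch goal with
  | |- L2 (fun t => th t * @?f t) => apply: (@L2_th f); go
  | |- L2 (fun t => zn _ t * @?f t) => apply: (@L2_znM _ f); go
  | |- L2 (fun _ => ?c) => exact: L2_cst
  | |- L2 (fun t => @?f t + - @?g t) => apply: (@L2B R f g); go
  | |- L2 (fun t => @?f t + @?g t) => apply: (@L2D R f g); go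
  | |- L2 (fun t => - @?f t) => apply: (@L2N R f); go
  | |- L2 (fun t => Num.conj (@?f t)) => apply: (@L2J R f); go
  | |- L2 (fun t => ?c * @?f t) => apply: (@L2Z R c f); go
  | |- L2 (fun t => ?f t) => change (L2 f); go
  | |- L2 (zn _) => exact: zn_L2
  | |- L2 (bshift _) => apply: bshift_L2; go
  | |- L2 th => exact: th_L2
  | |- L2 ?f => match goal with
      | H : L2 ?g |- _ => constr_eq f g; exact: H
      | H : model_space _ ?g |- _ => constr_eq f g; exact: (K_L2 H)
      end
  end.
(* [ring] compares atoms up to conversion, hence may unfold integrals. *)
Ltac generalize_inner :=
  repeat match goal with |- context [@cinner R ?a ?b] => generalize (@cinner R a b) end;
  repeat match goal with |- context [@value_at_0 R ?a] => generalize (@value_at_0 R a) end; intros.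
#[local] Hint Extern 0 (L2 _) => solve [solve_L2] : core.

Lemma ip_eq f g h k : (forall t, f t * (g t)^* = h t * (k t)^*) -> ip f g = ip h k.
Proof. by move=> e; congr (cint _ / _); apply/funext => t; exact: e. Qed.

Lemma ip_aeq f g h k : L2 f -> L2 g -> L2 h -> L2 k ->
  {ae mu, forall t, circ t -> f t * (g t)^* = h t * (k t)^*} -> ip f g = ip h k.
Proof.
move=> [f1 _] [g1 _] [h1 _] [k1 _] e; apply: cmean_ae => //.
- by apply: cmeasM => //; exact: cmeasJ.
- by apply: cmeasM => //; exact: cmeasJ.
Qed.

Lemma ipJ f g : ip (fun t => (f t)^*) (fun t => (g t)^*) = ip g f.
Proof. by apply: ip_eq => t; rewrite cconjK mulrC. Qed.

Lemma ip_th f g : L2 f -> L2 g -> ip (fun t => th t * f t) (fun t => th t * g t) = ip f g.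
Proof.
move=> f2 g2; apply: ip_aeq => //; apply: (ae_imp _ thJ) => t e tc.
by rewrite cconjM -[RHS]mul1r -(e tc); ring.
Qed.

Lemma ip_one_zn n : ip one (zn n) = (n == 0)%:R.
Proof. by rewrite -zn0E ip_zn_zn eq_sym. Qed.

Lemma th_zn n : n <= 0 -> ip th (zn n) = 0.
Proof.
rewrite le_eqVlt => /orP[/eqP ->|n0]; first by rewrite zn0E -value_at_0E.
by have /H2P[_ ->] := th_H2.
Qed.

Lemma ip_th_zn m n : n <= m -> ip (zn n) (fun t => th t * zn m t) = 0.
Proof.
move=> mn; rewrite (cinnerC _ (zn_L2 _ _)) //.
rewrite (@ip_eq _ _ th (zn (n - m))); first by rewrite th_zn ?cconj0 //; lia.
by move=> t; rewrite -mulrA -!znN -znD; congr (_ * zn _ t); lia.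
Qed.

(** Membership can be tested on characters: orthogonality of [f] to [th * H^2] is orthogonality of
    [conj th * f] to H^2, to which [orth_H2] applies. *)
Lemma KP f : K f <-> [/\ L2 f, forall n : int, n < 0 -> ip f (zn n) = 0 &
  forall n : int, 0 <= n -> ip f (fun t => th t * zn n t) = 0].
Proof.
split=> [[fh fo]|[f2 f1 fo]].
  have /H2P[f2 f1] := fh; split => // n n0; apply: fo; exact: H2_zn.
split; first by apply/H2P; split.
move=> g gh; rewrite (@ip_eq _ _ (fun t => (th t)^* * f t) g); last first.
  by move=> t; rewrite cconjM; ring.
apply: orth_H2 => //; first exact: L2Mb (cmeasJ th_meas) (ess_boundedJ th_bounded) f2.
move=> n n0; rewrite -(fo n n0); apply: ip_eq => t; rewrite cconjM; ring.
Qed.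

Lemma K_lin c f g : K f -> K g -> K (fun t => c * f t + g t).
Proof.
move=> /KP[f2 f1 fo] /KP[g2 g1 go]; apply/KP; split => // n n0.
  by rewrite cinnerDl // cinnerZl // f1 // g1 // mulr0 addr0.
by rewrite cinnerDl // cinnerZl // fo // go // mulr0 addr0.
Qed.

(** This rests on [th(0) = 0]: the constant 1 is orthogonal to every [th * z^n] with [n >= 0],
    including [n = 0]. *)
Lemma K_one : K one.
Proof.
apply/KP; split => // n n0; first by rewrite ip_one_zn; case: eqP => // e; lia.
by rewrite -zn0E ip_th_zn.
Qed.

Lemma K_zero : K (fun=> 0).
Proof.
have := K_lin (-1) K_one K_one; under eq_fun do rewrite mulr1 addNr.
exact.
Qed.

Lemma K_D f g : K f -> K g -> K (fun t => f t + g t).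
Proof. by move=> kf kg; have := K_lin 1 kf kg; under eq_fun do rewrite mul1r. Qed.
Lemma K_Z c f : K f -> K (fun t => c * f t).
Proof. by move=> kf; have := K_lin c kf K_zero; under eq_fun do rewrite addr0. Qed.
Lemma K_B f g : K f -> K g -> K (fun t => f t - g t).
Proof.
move=> kf kg; have := K_lin (-1) kg kf.
by under eq_fun do rewrite mulN1r addrC.
Qed.
Lemma K_cst c : K (fun=> c).
Proof. by have := K_Z c K_one; under eq_fun do rewrite mulr1. Qed.

(** Pairing [S* f] with [th * z^n] is pairing [f - f(0)], again in [K_th], with [th * z^(n+1)]. *)
Lemma K_bshift f : K f -> K (bshift f).
Proof.
move=> kf; have kb : K (fun t => f t - value_at_0 f) by apply: K_B => //; exact: K_cst.
apply/KP; split => //.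
  by have /H2P[] := H2_bshift (K_H2 kf).
move=> n n0; rewrite ip_bshift (@ip_eq _ _ (fun t => f t - value_at_0 f) (fun t => th t * zn (1 + n) t)).
  by case/KP: kb => _ _; apply; lia.
by move=> t; rewrite znD; congr (_ * _); rewrite !cconjM; ring.
Qed.

Lemma bshift_bounded f : ess_bounded f -> ess_bounded (bshift f).
Proof.
move=> fb; apply: ess_boundedM; first exact: zn_bounded.
by apply: ess_boundedD => //; exact: ess_bounded_cst.
Qed.

(* The conjugation [C]. *)
Definition conjK f : R -> C := fun t => th t * (zn 1 t * f t)^*.

Lemma conjK_L2 f : L2 f -> L2 (conjK f).
Proof. by move=> f2; rewrite /conjK. Qed.

Lemma conjK_ip f g : ip f (conjK g) = ip g (conjK f).
Proof. by apply: ip_eq => t; rewrite /conjK !(cconjM, cconjK); ring. Qed.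

Lemma conjK_sqnorm f : L2 f -> sqnorm (conjK f) = sqnorm f.
Proof.
move=> f2; have -> : sqnorm (conjK f) = sqnorm (fun t => zn 1 t * f t); last exact: sqnorm_zn.
by rewrite /sqnorm /conjK ip_th // ipJ.
Qed.

Lemma conjK_bounded f : ess_bounded f -> ess_bounded (conjK f).
Proof.
move=> fb; apply: ess_boundedM; first exact: th_bounded.
by apply/ess_boundedJ/ess_boundedM => //; exact: zn_bounded.
Qed.

(** The conjugation exchanges the two orthogonality conditions of [KP], sending the index [n] to
    [- n - 1]. *)
Lemma K_conjK f : K f -> K (conjK f).
Proof.
move=> /KP[f2 f1 fo]; apply/KP; split; first exact: conjK_L2.
- move=> n n0; rewrite (cinnerC (zn_L2 _ n) (conjK_L2 f2)).
  rewrite conjK_ip (@ip_eq _ _ f (fun t => th t * zn (- n - 1) t)); first by rewrite fo ?cconj0 //; lia.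
  move=> t; rewrite /conjK !(cconjM, cconjK); congr (_ * (_ * _)).
  by rewrite -!znN -znD; congr zn; lia.
- move=> n n0; rewrite /conjK ip_th //.
  rewrite (@ip_eq _ _ (zn (- n - 1)) f); first by rewrite cinnerC // f1 ?cconj0 //; lia.
  move=> t; rewrite cconjM mulrAC; congr (_ * _).
  by rewrite -!znN -znD; congr zn; lia.
Qed.

Lemma th_apoly_H2 w : apoly w -> H2 (fun t => th t * w t).
Proof.
elim=> [n|p q ap hp aq hq|c p ap hp].
- apply/H2P; split => // m m0; rewrite (@ip_eq _ _ th (zn (m - n%:Z))); first by rewrite th_zn //; lia.
  by move=> t; rewrite -mulrA -!znN -znD; congr (_ * zn _ t); lia.
- have := H2D hp hq; by under eq_fun do rewrite -mulrDr.
- have := H2Z c hp; by under eq_fun do rewrite mulrCA.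
Qed.

Lemma apoly_sum n (F : nat -> C) : apoly (fun t => \sum_(j < n) F j * zn j t).
Proof.
elim: n => [|n ih].
  have -> : (fun t => \sum_(j < 0) F j * zn j t) = (fun t => 0 * zn 0%N t).
    by apply/funext => t; rewrite big_ord0 mul0r.
  by apply: apolyZ; exact: apoly_zn.
under eq_fun do rewrite big_ord_recr /=.
by apply: apolyD => //; apply: apolyZ; exact: apoly_zn.
Qed.

Lemma ip_sum_zn n (F : nat -> C) (m : nat) :
  ip (fun t => \sum_(j < n) F j * zn j t) (zn m) = if (m < n)%N then F m else 0.
Proof.
elim: n => [|n ih].
  have -> : (fun t : R => \sum_(j < 0) F j * zn j t) = (fun t => 0 * one t).
    by apply/funext => t; rewrite big_ord0 mul0r.
  by rewrite cinnerZl // mul0r.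
have a2 := H2_L2 (apoly_H2 (apoly_sum n F)).
under [X in ip X _]eq_fun do rewrite big_ord_recr /=.
rewrite cinnerDl // cinnerZl // ih ip_zn_zn eqz_nat (eq_sym n m) ltnS [in RHS]leq_eqVlt.
by case: (eqVneq m n) => [->|nm] /=; rewrite ?ltnn ?mulr1 ?mulr0 ?add0r ?addr0.
Qed.

(* The projection of [z^n] is [z^n - th * w], where [w] carries the Fourier
   coefficients of index [>= 0] of [conj th * z^n]. *)
Lemma proj_zn (n : nat) : exists q, [/\ K q, ess_bounded q &
  forall g, K g -> ip (fun t => zn n t - q t) g = 0].
Proof.
(* The coefficient of [z^j] in [conj th * z^n]. It vanishes for [j > n], since [th] has no negative
   frequencies, so a sum up to [n] is complete. *)
pose F (j : nat) : C := (ip th (zn (n%:Z - j%:Z)))^*.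
pose w t : C := \sum_(j < n.+1) F j * zn j t.
have aw : apoly w by exact: apoly_sum.
have tw := th_apoly_H2 aw; have tw2 := H2_L2 tw; have w2 := H2_L2 (apoly_H2 aw).
have e : (fun t => zn n t - (zn n t - th t * w t)) = fun t => th t * w t.
  by apply/funext => t; ring.
exists (fun t => zn n t - th t * w t); split.
- apply/KP; split => //.
    move=> m m0; rewrite cinnerBl // ip_zn_zn; have /H2P[_ ->] := tw => //.
    by case: eqP => // nm; [lia|rewrite subr0].
  move=> m m0; rewrite cinnerBl // ip_th //.
  have -> : ip (zn n) (fun t => th t * zn m t) = (ip th (zn (n%:Z - m)))^*.
    rewrite -cinnerC //; apply: ip_eq => t; rewrite cconjM -!znN mulrCA -znD mulrC.
    by congr (zn _ t * _); lia.
  case: m m0 => // m _; rewrite ip_sum_zn; case: ltnP => [mn|nm]; first by rewrite subrr.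
  by rewrite th_zn ?cconj0 ?subr0 //; lia.
- apply: ess_boundedD; first exact: zn_bounded.
  have -> : (fun t => - (th t * w t)) = fun t => -1 * (th t * w t).
    by apply/funext => t; rewrite mulN1r.
  apply: ess_boundedM; first exact: ess_bounded_cst.
  by apply: ess_boundedM; [exact: th_bounded|exact: apoly_bounded].
- move=> g [gh go]; rewrite e (cinnerC (H2_L2 gh)) // go ?cconj0 //; exact: apoly_H2.
Qed.

Lemma proj_apoly p : apoly p -> exists q, [/\ K q, ess_bounded q &
  forall g, K g -> ip (fun t => p t - q t) g = 0].
Proof.
elim=> [n|p1 p2 a1 [q1 [k1 b1 o1]] a2 [q2 [k2 b2 o2]]|c p1 a1 [q1 [k1 b1 o1]]]; first exact: proj_zn.
- have p12 := H2_L2 (apoly_H2 a1); have p22 := H2_L2 (apoly_H2 a2).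
  exists (fun t => q1 t + q2 t); split; [exact: K_D|exact: ess_boundedD|].
  move=> g kg; rewrite (_ : (fun t => _) = fun t => (p1 t - q1 t) + (p2 t - q2 t)).
    by rewrite cinnerDl // o1 // o2 // addr0.
  by apply/funext => t; ring.
- have p12 := H2_L2 (apoly_H2 a1).
  exists (fun t => c * q1 t); split; [exact: K_Z| |].
    by apply: ess_boundedM => //; exact: ess_bounded_cst.
  move=> g kg; rewrite (_ : (fun t => _) = fun t => c * (p1 t - q1 t)).
    by rewrite cinnerZl // o1 // mulr0.
  by apply/funext => t; ring.
Qed.

(** An analytic polynomial close to [f] is projected onto [K_th]; the projection is bounded and no
    farther from [f]. *)
Lemma K_dense f (e : R) : K f -> 0 < e ->
  exists q, [/\ K q, ess_bounded q & sqnorm (fun t => f t - q t) < e].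
Proof.
move=> kf e0; have [p [ap fp]] := apoly_dense (K_H2 kf) e0.
have [q [kq qb qo]] := proj_apoly ap; exists q; split => //.
apply: le_lt_trans fp; apply: sqnorm_le_orth => //; first exact/H2_L2/apoly_H2.
by apply: qo; exact: K_B.
Qed.

(** Only subtractivity is required of [L], so that linear and conjugate linear functionals are
    covered at once. *)
Lemma dense_vanish (L : (R -> C) -> C) (M : R) : 0 <= M ->
  (forall f g, K f -> K g -> L (fun t => f t - g t) = L f - L g) ->
  (forall f, K f -> cabs (L f) ^+ 2 <= M * sqnorm f) ->
  (forall f, K f -> ess_bounded f -> L f = 0) -> forall f, K f -> L f = 0.
Proof.
move=> M0 LB LM Lb f kf; apply: (approx_eq0 M0) => e e0.
have [q [kq qb fq]] := K_dense kf e0.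
have -> : L f = L (fun t => f t - q t) by rewrite LB // (Lb q) // subr0.
apply: (le_trans (LM _ (K_B kf kq))); by rewrite ler_wpM2l // ltW.
Qed.

Lemma K_total x : L2 x -> (forall l, K l -> ess_bounded l -> ip x l = 0) ->
  forall l, K l -> ip x l = 0.
Proof.
move=> x2 xl; apply: (dense_vanish (sqnorm_ge0 x)) => //.
- by move=> f g kf kg; rewrite cinnerBr.
- by move=> f kf; exact: cauchy_schwarz (K_L2 kf).
Qed.

Lemma K_eq x y : K x -> K y -> (forall l, K l -> ess_bounded l -> ip x l = ip y l) -> aeeq x y.
Proof.
move=> kx ky e; have kxy := K_B kx ky.
have : ip (fun t => x t - y t) (fun t => x t - y t) = 0.
  by apply: K_total => // l kl lb; rewrite cinnerBl // e // subrr.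
move=> h; have : sqnorm (fun t => x t - y t) = 0 by rewrite /sqnorm h.
move/(sqnorm_eq0 (K_L2 kxy)); apply: ae_imp => t ht tc; apply/eqP.
by rewrite -subr_eq0 ht.
Qed.


(* A weak form of [A = A_phi] in which [f] need not be bounded; it determines
   [A f] almost everywhere, by density of the bounded functions. *)
Definition tto_pairing phi (A : (R -> C) -> R -> C) := (forall f, K f -> K (A f)) /\
  forall f l, K f -> K l -> ess_bounded l -> ip (A f) l = ip f (fun t => (phi t)^* * l t).

(** With [u(0) = 0], the conjugate of [u] has strictly negative frequencies only. *)
Lemma ip_conj_l u k : K u -> value_at_0 u = 0 -> H2 k -> ip (fun t => (u t)^*) k = 0.
Proof.
move=> ku u0 hk; apply: orth_H2 => // n n0.
rewrite (@ip_eq _ _ (fun t => (u t)^*) (fun t => (zn (- n) t)^*)); last first.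
  by move=> t; rewrite znN cconjK.
rewrite ipJ cinnerC //; move: n0; rewrite le_eqVlt => /orP[/eqP <-|n0].
  by rewrite oppr0 zn0E -value_at_0E u0 cconj0.
by case/KP: ku => _ -> //; [rewrite cconj0|lia].
Qed.

Lemma ip_thmul u : K u -> ip u th = 0.
Proof.
case=> _ /(_ one (H2_cst 1)) h; rewrite -[RHS]h; apply: ip_eq => t.
by rewrite mulr1.
Qed.

Lemma ip_one_th : ip one th = 0. Proof. exact: ip_thmul K_one. Qed.

(** * The shift formula and the Gram form of [A] *)

Section ShiftFormula.
Variables (f g : R -> C) (A : (R -> C) -> R -> C).
Hypotheses (kf : K f) (kg : K g) (f0 : value_at_0 f = 0) (g0 : value_at_0 g = 0).
Hypothesis TA : tto_pairing (fun t => f t + (g t)^*) A.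

Let ft t := th t * (f t)^*.

Lemma ip_ft_one : ip one ft = 0.
Proof.
rewrite (@ip_eq _ _ f th) ?ip_thmul // => t.
by rewrite /ft cconjM cconjK mul1r mulrC.
Qed.

Let k' k : R -> C := fun t => k t - value_at_0 k.

Lemma L2_ft : L2 ft. Proof. by rewrite /ft. Qed.

Lemma bounded_phi l : ess_bounded l -> cmeasurable l ->
  L2 (fun t => (f t)^* * l t) /\ L2 (fun t => g t * l t).
Proof.
move=> lb lm; split.
- have -> : (fun t => (f t)^* * l t) = fun t => l t * (f t)^* by apply/funext => t; ring.
  exact: L2Mb.
- have -> : (fun t => g t * l t) = fun t => l t * g t by apply/funext => t; ring.
  exact: L2Mb.
Qed.

Lemma ip_phi k l : L2 k -> ess_bounded l -> cmeasurable l ->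
  ip k (fun t => (f t + (g t)^*)^* * l t) =
  ip k (fun t => (f t)^* * l t) + ip k (fun t => g t * l t).
Proof.
move=> k2 lb lm; have [h1 h2] := bounded_phi lb lm; rewrite -cinnerDr //.
by apply: ip_eq => t; rewrite !(cconjM, cconjD, cconjK); ring.
Qed.

Lemma ip_k_conj u k : K u -> value_at_0 u = 0 -> K k -> ip k (fun t => (u t)^*) = 0.
Proof. by move=> ku u0 kk; rewrite cinnerC // ip_conj_l ?cconj0 //; exact: K_H2. Qed.

(** The pairing becomes that of [A (S* k)] with [S* l], where the factors [conj z] cancel and leave
    the symbol between [k - k(0)] and [l - l(0)]. Expanding the two differences gives the rank one
    terms; the others vanish because [f(0) = g(0) = 0]. *)
Lemma shift_pairing k l : K k -> K l -> ess_bounded l ->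
  ip (fun t => zn 1 t * A (bshift k) t) l =
  ip k (fun t => (f t + (g t)^*)^* * l t) - (value_at_0 l)^* * ip k g - value_at_0 k * ip f l.
Proof.
move=> kk kl lb; have [KA pA] := TA; have ka := KA _ (K_bshift kk).
have lm : cmeasurable l by case: (K_L2 kl).
rewrite ip_zn.
(* The two right arguments differ by a multiple of [conj z], to which [A (S* k)] is orthogonal. *)
have -> : ip (A (bshift k)) (fun t => zn (- 1) t * l t) = ip (A (bshift k)) (bshift l).
  have -> : (fun t => zn (-1) t * l t) = fun t => bshift l t + value_at_0 l * zn (-1) t.
    by apply/funext => t; rewrite /bshift; ring.
  rewrite cinnerDr // cinnerZr //; case/KP: ka => _ -> //.
  by rewrite mulr0 addr0.
rewrite pA //; [|exact: K_bshift|exact: K_bshift|exact: bshift_bounded].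
have bl : ess_bounded (k' l) by apply: ess_boundedD => //; exact: ess_bounded_cst.
have ml : cmeasurable (k' l) by case: (L2B (K_L2 kl) (L2_cst (value_at_0 l))).
have K2 : L2 (k' k) by rewrite /k'.
rewrite (@ip_eq _ _ (k' k) (fun t => (f t + (g t)^*)^* * k' l t)); last first.
  move=> t; rewrite /bshift -/(k' k t) -/(k' l t) !cconjM -[RHS]mul1r -(znJ (-1) t); ring.
rewrite ip_phi // ip_phi //.
have [h1 h2] := bounded_phi lb lm; have f2 := K_L2 kf; have g2 := K_L2 kg.
have -> : ip (k' k) (fun t => (f t)^* * k' l t) = ip k (fun t => (f t)^* * l t) - value_at_0 k * ip f l.
  have -> : (fun t => (f t)^* * k' l t) = fun t => (f t)^* * l t - value_at_0 l * (f t)^*.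
    by apply/funext => t; rewrite /k'; ring.
  rewrite cinnerBr // cinnerZr // /k' cinnerBl // cinnerBl //.
  rewrite (ip_k_conj kf f0 kk) ip_cstl // ip_cstl //.
  have -> : value_at_0 (fun t => (f t)^*) = 0 by rewrite value_at_0E ip_conj_l //; exact: H2_cst.
  have -> : (value_at_0 (fun t => (f t)^* * l t))^* = ip f l.
    by rewrite value_at_0E -cinnerC //; apply: ip_eq => t; rewrite !(cconjM, cconjK); ring.
  rewrite cconj0; generalize_inner; ring.
have -> : ip (k' k) (fun t => g t * k' l t) = ip k (fun t => g t * l t) - (value_at_0 l)^* * ip k g.
  have -> : (fun t => g t * k' l t) = fun t => g t * l t - value_at_0 l * g t.
    by apply/funext => t; rewrite /k'; ring.
  rewrite cinnerBr // cinnerZr // /k' cinnerBl // cinnerBl //.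
  rewrite ip_cstl // ip_cstl // g0 cconj0 mulr0 subr0.
  have -> : (value_at_0 (fun t => g t * l t))^* = 0.
    rewrite value_at_0E -cinnerC // (@ip_eq _ _ (fun t => (g t)^*) l).
      by rewrite ip_conj_l //; exact: K_H2.
    by move=> t; rewrite !(cconjM, cconjK); ring.
  generalize_inner; ring.
generalize_inner; ring.
Qed.

(** The conjugate of 1: a bounded element of [K_th], hence a legitimate test function for the
    component of [z * A (S* k)] along [th]. *)
Lemma K_conj_zn : K (fun t => th t * zn (-1) t).
Proof.
have := K_conjK K_one; congr model_space; apply/funext => t.
by rewrite /conjK mulr1 znN.
Qed.

(* This is the coefficient that makes [shift_rhs] orthogonal to [th]. *)
Lemma shift_th k : K k -> ip (fun t => zn 1 t * A (bshift k) t) th = ip k ft.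
Proof.
move=> kk; have [KA pA] := TA; have bk := K_bshift kk; have f2 := K_L2 kf; have g2 := K_L2 kg.
rewrite ip_zn.
have -> : (fun t => zn (- 1) t * th t) = fun t => th t * zn (-1) t by apply/funext => t; ring.
rewrite pA //; [|exact: K_conj_zn|]; last first.
  by apply: ess_boundedM; [exact: th_bounded|exact: zn_bounded].
have K2 : L2 (k' k) by have := K_L2 kk; rewrite /k'.
rewrite (@ip_eq _ _ (k' k) (fun t => (f t + (g t)^*)^* * th t)); last first.
  by move=> t; rewrite /bshift -/(k' k t) !cconjM -[RHS]mul1r -(znJ (-1) t); ring.
rewrite ip_phi //; [|exact: th_bounded|exact: th_meas].
have -> : (fun t => (f t)^* * th t) = ft by apply/funext => t; rewrite /ft mulrC.
have -> : (fun t => g t * th t) = (fun t => th t * g t) by apply/funext => t; rewrite mulrC.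
have ft2 := L2_ft; rewrite /k' cinnerBl // cinnerBl //.
have [_ -> //] := kk; last exact: K_H2.
have c1 h : L2 h -> ip (fun=> value_at_0 k) h = value_at_0 k * ip one h.
  move=> h2; rewrite -cinnerZl // (_ : (fun t => value_at_0 k * one t) = fun=> value_at_0 k) //.
  by apply/funext => t; rewrite mulr1.
rewrite !c1 // ip_ft_one; have [_ -> //] := K_one; last exact: K_H2.
by rewrite !mulr0 !subr0 addr0.
Qed.

(** The factor [* 1] presents the third summand as a multiple of [one], in the shape that
    [gram_expand] takes. *)
Definition shift_rhs k : R -> C := fun t =>
  zn 1 t * A (bshift k) t + value_at_0 k * f t + ip k g * 1 - ip k ft * th t.

Lemma shift_rhs_K k : K k -> K (shift_rhs k).
Proof.
move=> kk; have [KA pA] := TA; have bk := K_bshift kk; have ka := KA _ bk.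
have f2 := K_L2 kf; have a2 := K_L2 ka.
apply/KP; split; first by rewrite /shift_rhs.
- move=> n n0; rewrite /shift_rhs cinnerBl // cinnerDl // cinnerDl // !cinnerZl //.
  rewrite ip_zn zn_zn; case/KP: ka => _ -> //; last by lia.
  case/KP: kf => _ -> //; have /H2P[_ -> //] := th_H2.
  by rewrite ip_one_zn; case: eqP => [e|_]; [lia|rewrite !mulr0 !addr0 subr0].
- move=> n n0; rewrite /shift_rhs cinnerBl // cinnerDl // cinnerDl // !cinnerZl //.
  case/KP: (kf) => _ _ -> //; case/KP: K_one => _ _ -> //.
  have -> : ip th (fun t => th t * zn n t) = (n == 0)%:R.
    by rewrite -ip_one_zn -[RHS]ip_th //; apply: ip_eq => t; rewrite mulr1.
  (* For [n >= 1] the factor [z] lowers [th * z^n] to [th * z^(n-1)], still orthogonal to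
     [A (S* k)]; only [n = 0] needs the coefficient of [th]. *)
  have [->|n1] := eqVneq n 0.
    rewrite (_ : (fun t => th t * zn 0 t) = th); last by apply/funext => t; rewrite zn0 mulr1.
    by rewrite shift_th // (_ : true%:R = 1 :> C) //; generalize_inner; ring.
  rewrite ip_zn (@ip_eq _ _ (A (bshift k)) (fun t => th t * zn (n - 1) t)).
    case/KP: ka => _ _ -> //; last by lia.
    by rewrite (_ : false%:R = 0 :> C) //; generalize_inner; ring.
  by move=> t; rewrite mulrCA -znD; congr (_ * (_ * zn _ _)^*); lia.
Qed.

Lemma shift_formula k : K k -> aeeq (A k) (shift_rhs k).
Proof.
move=> kk; have [KA pA] := TA; have bk := K_bshift kk; have ka := KA _ bk.
have f2 := K_L2 kf; have a2 := K_L2 ka.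
apply: K_eq => //; [exact: KA|exact: shift_rhs_K|] => l kl lb.
rewrite pA // /shift_rhs cinnerBl // cinnerDl // cinnerDl // !cinnerZl //.
rewrite shift_pairing // (cinnerC (K_L2 kl) th_L2) ip_thmul // cconj0.
by rewrite ip_cstl //; generalize_inner; ring.
Qed.

(** Both vectors are orthogonal to [w] by the choice of [l1] and [l2], so the three terms involving
    [w] add up to [- l1 * l2^*]. *)
Lemma gram_expand (z1 z2 u o w : R -> C) (k1 k2 b1 b2 l1 l2 : C) :
  L2 z1 -> L2 z2 -> L2 u -> L2 o -> L2 w ->
  ip z1 o = 0 -> ip z2 o = 0 -> ip z1 w = l1 -> ip z2 w = l2 ->
  ip u o = 0 -> ip u w = 0 -> ip o w = 0 -> ip o o = 1 -> ip w w = 1 ->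
  ip (fun t => z1 t + k1 * u t + b1 * o t - l1 * w t)
     (fun t => z2 t + k2 * u t + b2 * o t - l2 * w t) =
  ip z1 z2 + k2^* * ip z1 u + k1 * (ip z2 u)^* + k1 * k2^* * ip u u + b1 * b2^* - l1 * l2^*.
Proof.
move=> z1L z2L uL oL wL z1o z2o z1w z2w uo uw ow oo ww.
rewrite cinnerBl // cinnerDl // cinnerDl // !cinnerZl //.
rewrite !(cinnerBr, cinnerDr, cinnerNr, cinnerZr) //.
rewrite (cinnerC z2L uL) (cinnerC z2L oL) (cinnerC z2L wL) (cinnerC uL oL) (cinnerC uL wL) (cinnerC oL wL).
by rewrite z1o z2o z1w z2w uo uw ow oo ww !cconj0; generalize_inner; ring.
Qed.

Lemma gram k l : K k -> K l -> ip (A k) (A l) =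
  ip (A (bshift k)) (A (bshift l)) +
  (value_at_0 l)^* * ip (A (bshift k)) (bshift f) + value_at_0 k * (ip (A (bshift l)) (bshift f))^* +
  value_at_0 k * (value_at_0 l)^* * ip f f + ip k g * (ip l g)^* - ip k ft * (ip l ft)^*.
Proof.
move=> kk kl; have [KA pA] := TA.
have s2 x : K x -> L2 (shift_rhs x) by move/shift_rhs_K/K_L2.
have mm x : L2 x -> cmeasurable x by case.
have z1 x : K x -> ip (fun t => zn 1 t * x t) one = 0.
  move=> kx; rewrite ip_zn (@ip_eq _ _ x (zn (-1))); first by case/KP: kx => _ ->.
  by move=> t; rewrite mulr1.
have zf x : K x -> ip (fun t => zn 1 t * x t) f = ip x (bshift f).
  by move=> kx; rewrite ip_zn; apply: ip_eq => t; rewrite /bshift f0 subr0.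
have e1 : ip (A k) (A l) = ip (shift_rhs k) (shift_rhs l).
  apply: cinner_ae; try exact: shift_formula.
  - exact/mm/K_L2/KA.
  - exact/mm/s2.
  - exact/mm/K_L2/KA.
  - exact/mm/s2.
have zz : ip (fun t => zn 1 t * A (bshift k) t) (fun t => zn 1 t * A (bshift l) t) =
    ip (A (bshift k)) (A (bshift l)).
  by apply: ip_eq => t; rewrite cconjM mulrACA znJ mul1r.
have thth : ip th th = 1.
  rewrite (@ip_eq _ _ (fun t => th t * one t) (fun t => th t * one t)); last by move=> t; rewrite mulr1.
  by rewrite ip_th // -zn0E ip_zn_zn.
have oo : ip one one = 1 by rewrite -zn0E ip_zn_zn.
have kb1 := KA _ (K_bshift kk); have kb2 := KA _ (K_bshift kl).
have L2z x : K x -> L2 (fun t => zn 1 t * x t) by move=> /K_L2; exact: L2_znM.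
have := @gram_expand _ _ f one th (value_at_0 k) (value_at_0 l) (ip k g) (ip l g) (ip k ft) (ip l ft)
  (L2z _ kb1) (L2z _ kb2) (K_L2 kf) (L2_cst 1) th_L2 (z1 _ kb1) (z1 _ kb2)
  (shift_th kk) (shift_th kl) _ (ip_thmul kf) ip_one_th oo thth.
by rewrite -value_at_0E f0 => /(_ erefl); rewrite e1 zz !zf.
Qed.

End ShiftFormula.

(** * Adjoints, and extension from bounded functions *)

Definition adjK (A B : (R -> C) -> R -> C) :=
  forall f g, K f -> K g -> ip (A f) g = ip f (B g).

Definition compresses phi (A : (R -> C) -> R -> C) :=
  forall f g, K f -> ess_bounded f -> K g -> ip (A f) g = ip (fun t => phi t * f t) g.

Lemma L2_bM phi l : L2 phi -> ess_bounded l -> cmeasurable l -> L2 (fun t => phi t * l t).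
Proof.
move=> p2 lb lm; have -> : (fun t => phi t * l t) = fun t => l t * phi t.
  by apply/funext => t; rewrite mulrC.
exact: L2Mb.
Qed.

Lemma L2_bMJ phi l : L2 phi -> ess_bounded l -> cmeasurable l -> L2 (fun t => (phi t)^* * l t).
Proof. by move=> p2; apply: L2_bM; exact: L2J. Qed.

Lemma K_meas f : K f -> cmeasurable f. Proof. by move/K_L2 => []. Qed.

(** The adjoint has the conjugate symbol. The test function [l] is bounded, so [A l] is given
    directly by the compression and no density argument is involved. *)
Lemma adjK_tto_pairing phi A B : L2 phi -> compresses phi A -> adjK A B ->
  (forall f, K f -> K (A f)) -> (forall f, K f -> K (B f)) -> tto_pairing (fun t => (phi t)^*) B.
Proof.
move=> p2 cA AB KA KB; split => // f l kf kl lb.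
rewrite (cinnerC (K_L2 kl) (K_L2 (KB _ kf))) -AB // cA //.
have pl := L2_bM p2 lb (K_meas kl).
by rewrite -(cinnerC pl (K_L2 kf)); apply: ip_eq => t; rewrite cconjK.
Qed.

Lemma cabsB2 (x y : C) : cabs (x - y) ^+ 2 <= 2 * cabs x ^+ 2 + 2 * cabs y ^+ 2.
Proof.
rewrite !cabs2E !creimE; have := sqr_ge0 (cre x + cre y); have := sqr_ge0 (cim x + cim y).
by nra.
Qed.

(** The part of linearity that [dense_vanish] consumes, stated inside the inner product because [A]
    is linear only up to a.e. equality. *)
Definition subtractive (A : (R -> C) -> R -> C) := forall f g l, K f -> K g -> K l ->
  ip (A (fun t => f t - g t)) l = ip (A f) l - ip (A g) l.

Definition sqnorm_bounded (A : (R -> C) -> R -> C) (M : R) :=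
  0 <= M /\ forall f, K f -> sqnorm (A f) <= M * sqnorm f.

(** For fixed bounded [l], both sides of the pairing are continuous in [f], and they agree on the
    dense set of bounded [f]. *)
Lemma compresses_tto_pairing phi A M : L2 phi -> (forall f, K f -> K (A f)) -> compresses phi A ->
  subtractive A -> sqnorm_bounded A M -> tto_pairing phi A.
Proof.
move=> p2 KA cA sA [M0 bA]; split => // f l kf kl lb.
have pl := L2_bMJ p2 lb (K_meas kl); have l2 := K_L2 kl.
apply/eqP; rewrite -subr_eq0; apply/eqP; move: f kf.
apply: (@dense_vanish (fun f => ip (A f) l - ip f (fun t => (phi t)^* * l t))
  (2 * M * sqnorm l + 2 * sqnorm (fun t => (phi t)^* * l t))).
- by rewrite addr_ge0 ?mulr_ge0 ?sqnorm_ge0.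
- by move=> f g kf kg; rewrite sA // cinnerBl //; generalize_inner; ring.
- move=> f kf; apply: (le_trans (cabsB2 _ _)).
  have h1 := cauchy_schwarz (K_L2 (KA _ kf)) l2; have h2 := cauchy_schwarz (K_L2 kf) pl.
  have h3 := ler_wpM2r (sqnorm_ge0 l) (bA _ kf).
  move: h1 h2 h3; move: (cabs _ ^+ 2) (cabs _ ^+ 2) (sqnorm _) (sqnorm _) (sqnorm _) (sqnorm _) => a b c d e h.
  by nra.
- by move=> f kf fb; rewrite cA // ipM subrr.
Qed.

Lemma conjK_B f g : conjK (fun t => f t - g t) = fun t => conjK f t - conjK g t.
Proof. by apply/funext => t; rewrite /conjK !(cconjM, cconjB); ring. Qed.

(** Complex symmetry of truncated Toeplitz operators: on bounded [g] the factors [th] and [z] of the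
    two conjugations cancel and the conjugate symbol appears; density does the rest. *)
Lemma conjK_adj phi A M : L2 phi -> (forall f, K f -> K (A f)) -> compresses phi A ->
  subtractive A -> sqnorm_bounded A M -> adjK A (fun h => conjK (A (conjK h))).
Proof.
move=> p2 KA cA sA bA f g kf.
have [_ TA] := compresses_tto_pairing p2 KA cA sA bA; have [M0 bA'] := bA.
have f2 := K_L2 kf; have Af2 := K_L2 (KA _ kf); have cf := K_conjK kf; have cf2 := K_L2 cf.
move=> kg; apply/eqP; rewrite -subr_eq0; apply/eqP; move: g kg.
apply: (@dense_vanish (fun g => ip (A f) g - ip f (conjK (A (conjK g))))
  (2 * sqnorm (A f) + 2 * M * sqnorm f)).
- by rewrite addr_ge0 ?mulr_ge0 ?sqnorm_ge0.
- move=> g h kg kh; rewrite !(conjK_ip f) conjK_B sA //; [|exact: K_conjK|exact: K_conjK].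
  by rewrite cinnerBr //; generalize_inner; ring.
- move=> g kg; apply: (le_trans (cabsB2 _ _)); rewrite conjK_ip.
  have kcg := K_conjK kg.
  have h1 := cauchy_schwarz Af2 (K_L2 kg); have h2 := cauchy_schwarz (K_L2 (KA _ kcg)) cf2.
  have h3 := ler_wpM2r (sqnorm_ge0 f) (bA' _ kcg).
  move: h1 h2 h3; rewrite !conjK_sqnorm //.
  move: (cabs _ ^+ 2) (cabs _ ^+ 2) (sqnorm _) (sqnorm _) (sqnorm _) (sqnorm _) => a b c d e h.
  by nra.
- move=> g kg gb; rewrite TA // conjK_ip cA //; [|exact: K_conjK|exact: conjK_bounded].
  apply/eqP; rewrite subr_eq0; apply/eqP.
  have lm := K_meas kg; have kcg := K_conjK kg.
  apply: ip_aeq => //; first exact: L2_bMJ.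
    by apply: L2_bM => //; [exact: conjK_bounded|exact: K_meas].
  apply: (ae_imp _ thJ) => t e tc; rewrite /conjK !(cconjM, cconjK) -[LHS]mul1r -(e tc).
  by rewrite -[LHS]mul1r -(znJ 1 t); ring.
Qed.

(** Linearity is not part of [tto_pairing], so the vanishing of [A 0] is read off from test
    functions. It serves for [S* 1 = 0]. *)
Lemma tto_pairing_zero phi A x : tto_pairing phi A -> K x -> ip (A (fun=> 0)) x = 0.
Proof.
move=> [KA TA] kx; have k0 := KA _ K_zero; apply: K_total => //.
move=> l kl lb; rewrite TA //; last exact: K_zero.
rewrite (@ip_eq _ _ (fun=> 0) one); first by rewrite ip_cstl // mul0r.
by move=> t; rewrite !mul0r.
Qed.

(** * The defect of normality *)

Section Core.
Variables (f g : R -> C) (A B : (R -> C) -> R -> C).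
Hypotheses (kf : K f) (kg : K g) (f0 : value_at_0 f = 0) (g0 : value_at_0 g = 0).
Hypothesis TA : tto_pairing (fun t => f t + (g t)^*) A.
Hypothesis TB : tto_pairing (fun t => g t + (f t)^*) B.
Hypothesis AB : adjK A B.
Let ft t := th t * (f t)^*.
Let gt t := th t * (g t)^*.
Let Q k l := ip (A k) (A l) - ip (B k) (B l).
Let D x := ip (A x) (bshift f) - ip (B x) (bshift g).

Lemma normality_defect k l : K k -> K l -> Q k l = Q (bshift k) (bshift l) +
  (value_at_0 l)^* * D (bshift k) + value_at_0 k * (D (bshift l))^* +
  value_at_0 k * (value_at_0 l)^* * (ip f f - ip g g) +
  ((ip k g * (ip l g)^* - ip k ft * (ip l ft)^*) - (ip k f * (ip l f)^* - ip k gt * (ip l gt)^*)).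
Proof.
move=> kk kl; rewrite /Q /D cconjB (gram kf kg f0 g0 TA kk kl) (gram kg kf g0 f0 TB kk kl).
by rewrite -/ft -/gt; generalize_inner; ring.
Qed.

(** Multiplying the conjugate by [th] reverses frequencies, [n] to [- n], and exchanges the two
    conditions of [KP]; index 0 is where [u(0) = 0] is used. *)
Lemma K_twist u : K u -> value_at_0 u = 0 -> K (fun t => th t * (u t)^*) /\
  value_at_0 (fun t => th t * (u t)^*) = 0.
Proof.
move=> ku u0; have u2 := K_L2 ku; split.
  apply/KP; split => // n n0.
    rewrite (@ip_eq _ _ (zn (- n)) (fun t => (th t)^* * u t)); last first.
      by move=> t; rewrite znN !(cconjM, cconjK); ring.
    rewrite -(@ip_eq (fun t => th t * zn (- n) t) u); last by move=> t; rewrite !(cconjM, cconjK); ring.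
    by rewrite cinnerC //; case/KP: ku => _ _ ->; [rewrite cconj0|lia].
  rewrite ip_th // (@ip_eq _ _ (zn (- n)) u); last by move=> t; rewrite znN mulrC.
  rewrite cinnerC //; move: n0; rewrite le_eqVlt => /orP[/eqP <-|n0].
    by rewrite oppr0 zn0E -value_at_0E u0 cconj0.
  by case/KP: ku => _ ->; [rewrite cconj0|lia].
rewrite value_at_0E (@ip_eq _ _ th u); last by move=> t; rewrite cconj1 mulr1.
by rewrite cinnerC // ip_thmul // cconj0.
Qed.

Lemma defect_zero_symbols : (forall k l, K k -> K l -> ip (A k) (A l) = ip (B k) (B l)) ->
  exists alpha : C, cabs alpha = 1 /\
    (aeeq g (fun t => alpha * f t) \/ aeeq g (fun t => alpha * ft t)).
Proof.
move=> H; have Q0 k l : K k -> K l -> Q k l = 0 by move=> kk kl; rewrite /Q H // subrr.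
have f2 := K_L2 kf; have g2 := K_L2 kg.
have [kft ft0] := K_twist kf f0; have [kgt gt0] := K_twist kg g0.
have ft2 : L2 ft := K_L2 kft; have gt2 : L2 gt := K_L2 kgt.
(* On functions vanishing at the origin, only the rank one terms of the defect recursion survive. *)
have br k l : K k -> K l -> value_at_0 k = 0 -> value_at_0 l = 0 ->
    ip k g * (ip l g)^* - ip k ft * (ip l ft)^* = ip k f * (ip l f)^* - ip k gt * (ip l gt)^*.
  move=> kk kl k0 l0; have := normality_defect kk kl.
  rewrite (Q0 _ _ kk kl) (Q0 _ _ (K_bshift kk) (K_bshift kl)).
  rewrite k0 l0 cconj0 !mul0r !addr0 add0r => /esym/eqP.
  by rewrite subr_eq0 => /eqP.
(* Taken at [k = l = 1]: [S* 1 = 0], and 1 is orthogonal to [f], [g] and their twists, so the norm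
   difference is all that remains. *)
have nfg : ip f f = ip g g.
  have kb1 := K_bshift K_one; have := normality_defect K_one K_one.
  rewrite (Q0 _ _ K_one K_one) (Q0 _ _ kb1 kb1).
  have v1 : value_at_0 one = 1 by rewrite value_at_0E -zn0E ip_zn_zn.
  have -> : bshift one = fun=> 0.
    by apply/funext => t; rewrite /bshift v1 subrr mulr0.
  rewrite /D (tto_pairing_zero TA (K_bshift kf)) (tto_pairing_zero TB (K_bshift kg)) subrr cconj0.
  rewrite !ip_cstl // ft0 gt0 f0 g0 cconj0 v1 cconj1 !mulr0 !mul0r !mul1r.
  rewrite !subrr !addr0 !add0r => /esym/eqP; by rewrite subr_eq0 => /eqP.
pose p := sqnorm f; pose u := ip g f; pose w := ip g ft; pose r := ip f ft.
have ff : ip f f = p%:C by exact: cinner_self.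
have gg : ip g g = p%:C by rewrite -nfg.
have ftft : ip ft ft = p%:C by rewrite /ft ip_th // ipJ.
have fg : ip f g = u^* by rewrite (cinnerC g2 f2).
have fgt : ip f gt = w by apply: ip_eq => t; rewrite !(cconjM, cconjK); ring.
have ftg : ip ft g = w^* by rewrite (cinnerC g2 ft2).
have ftgt : ip ft gt = u by rewrite /ft /gt ip_th // ipJ.
have ftf : ip ft f = r^* by rewrite (cinnerC f2 ft2).
have b1 := br f f kf kf f0 f0; have b2 := br f ft kf kft f0 ft0.
move: b1 b2; rewrite !ff fg fgt ftft ftg ftgt ftf -/r !cconjK !mulcJ => b1 b2.
have P0 : 0 <= p by exact: sqnorm_ge0.
(* [e1] is the relation at [(f, f)]; [e2] takes moduli in the one at [(f, ft)], which reads
   [p r = u^* w]. *)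
have e1 : cabs u ^+ 2 + cabs w ^+ 2 = p ^+ 2 + cabs r ^+ 2.
  have := congr1 (@cre R) b1; rewrite (mulrC (u^*)) !mulcJ cabs_real ger0_norm // !creimE /=; lra.
have e2 : p * cabs r = cabs u * cabs w.
  have : p%:C * r = u^* * w.
    have pp : (p%:C)^* = p%:C by exact: conjc_real.
    have alg (p' r' u' w' : C) : u' * w' - r' * p' = p' * r' - w' * u' -> 2 * (p' * r') = 2 * (u' * w').
      move=> h; have -> : 2 * (p' * r') = (p' * r' - w' * u') + r' * p' + w' * u' by ring.
      by rewrite -h; ring.
    have : 2 * (p%:C * r) = 2 * (u^* * w) by apply: alg; move: b2; rewrite pp.
    by apply: mulfI; rewrite pnatr_eq0.
  move=> h; have := congr1 (@cabs R) h; by rewrite (cabsM p%:C r) (cabsM (u^*) w) cabsJ cabs_real ger0_norm.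
(* The pairs [|u|^2, |w|^2] and [p^2, |r|^2] have equal sums and equal products, so [p^2] is one of
   [|u|^2, |w|^2]. *)
have prod0 : (cabs u ^+ 2 - p ^+ 2) * (cabs w ^+ 2 - p ^+ 2) = 0.
  have alg2 (a b c d : R) : a + b = d + c -> d * c = a * b -> (a - d) * (b - d) = 0.
    move=> h1 h2; have -> : (a - d) * (b - d) = a * b - d * (a + b) + d * d by ring.
    by rewrite -h2 h1; ring.
  by apply: (alg2 _ _ _ _ e1); rewrite -!exprMn e2.
have final h : L2 h -> ip h h = p%:C -> cabs (ip g h) ^+ 2 = p ^+ 2 ->
    exists alpha : C, cabs alpha = 1 /\ aeeq g (fun t => alpha * h t).
  move=> h2 hh gh; have [p0|p0] := eqVneq p 0.
    exists 1; split; first exact: cabs1.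
    have gz : aeeq g (fun=> 0) by apply: sqnorm_eq0 => //; rewrite /sqnorm gg p0.
    have hz : aeeq h (fun=> 0) by apply: sqnorm_eq0 => //; rewrite /sqnorm hh p0.
    by apply: (ae_imp _ (ae_and gz hz)) => t [z1 z2] tc; rewrite z1 // z2 // mulr0.
  have cu : cabs (ip g h) = p.
    by apply/eqP; rewrite -(@eqrXn2 _ 2) ?cabs_ge0 // gh.
  (* The projection coefficient of [g] along [h]: it is unimodular, and the remainder has squared
     norm [p - p]. The case [p = 0] was separate, as there [g] and [h] vanish and any unimodular
     constant works. *)
  exists (ip g h / p%:C); split.
    by rewrite (cabsM (ip g h)) realCV cabs_real cu ger0_norm ?invr_ge0 // mulfV.
  have d2 : L2 (fun t => g t - ip g h / p%:C * h t) by [].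
  have : sqnorm (fun t => g t - ip g h / p%:C * h t) = 0.
    rewrite sqnormB // sqnormZ // cinnerZr // /sqnorm gg hh (cabsM (ip g h)) realCV cabs_real cu ger0_norm ?invr_ge0 //.
    have -> : (ip g h * (p^-1)%:C)^* * ip g h = p%:C.
      rewrite cconjM (_ : ((p^-1)%:C)^* = (p^-1)%:C); last exact: conjc_real.
      rewrite mulrAC mulrC (mulrC _ (ip g h)) mulcJ cu -realCM; congr _%:C.
      by field.
    by rewrite /=; field.
  move/(sqnorm_eq0 d2); apply: ae_imp => t z tc; apply/eqP; by rewrite -subr_eq0 z.
move/eqP: prod0; rewrite mulf_eq0 !subr_eq0 => /orP[/eqP h|/eqP h].
  by have [al [a1 ga]] := final f f2 ff h; exists al; split => //; left.
by have [al [a1 ga]] := final ft ft2 ftft h; exists al; split => //; right.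
Qed.

(** The a.e. hypothesis amounts to [|f| = |g|]; it is written as the equality, up to the factor
    [conj z], of the products that define [B (S* f)] and [A (S* g)]. *)
Lemma symbols_defect_zero MA MB : sqnorm_bounded A MA -> sqnorm_bounded B MB ->
  {ae mu, forall t, circ t -> f t * (g t + (f t)^*) = g t * (f t + (g t)^*)} ->
  ip f f = ip g g ->
  (forall k l, K k -> K l -> ip k g * (ip l g)^* - ip k ft * (ip l ft)^* =
    ip k f * (ip l f)^* - ip k gt * (ip l gt)^*) ->
  forall k l, K k -> K l -> ip (A k) (A l) = ip (B k) (B l).
Proof.
move=> [MA0 bA] [MB0 bB] ae nfg br.
have [KA pA] := TA; have [KB pB] := TB.
have kF := K_bshift kf; have kG := K_bshift kg.
have f2 := K_L2 kf; have g2 := K_L2 kg.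
have BFAG : aeeq (B (bshift f)) (A (bshift g)).
  apply: K_eq; [exact: KB|exact: KA|] => l kl lb; rewrite pB // pA //.
  have lm := K_meas kl; have l2 := K_L2 kl.
  have L2a : L2 (fun t => (g t + (f t)^*)^* * l t).
    by apply: L2_bM => //; apply: L2J; apply: L2D => //; exact: L2J.
  have L2b : L2 (fun t => (f t + (g t)^*)^* * l t).
    by apply: L2_bM => //; apply: L2J; apply: L2D => //; exact: L2J.
  apply: ip_aeq => //; apply: (ae_imp _ ae) => t e tc.
  rewrite /bshift f0 g0 !subr0 !(cconjM, cconjK) -!mulrA; congr (_ * _).
  by rewrite !mulrA e.
have D0 x : K x -> D x = 0.
  move=> kx; rewrite /D AB //.
  have -> : ip (B x) (bshift g) = ip x (A (bshift g)).
    by rewrite (cinnerC (K_L2 kG) (K_L2 (KB _ kx))) -AB // -cinnerC //; exact/K_L2/KA.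
  apply/eqP; rewrite subr_eq0; apply/eqP; apply: cinner_ae => //.
  - exact: K_meas.
  - exact: K_meas.
  - exact/K_meas/KB.
  - exact/K_meas/KA.
  - exact: ae_all.
have rec k l : K k -> K l -> Q k l = Q (bshift k) (bshift l).
  move=> kk kl; rewrite normality_defect // !D0; try exact: K_bshift.
  by rewrite nfg br // !subrr cconj0 !mulr0 !addr0.
have Kit (n : nat) (k : R -> C) : K k -> K (iter n (@bshift R) k).
  by move=> kk; elim: n => [|n ih]; [exact: kk|exact: (K_bshift ih)].
have recn (n : nat) (k l : R -> C) : K k -> K l -> Q k l = Q (iter n (@bshift R) k) (iter n (@bshift R) l).
  by move=> kk kl; elim: n => [|n ->]; [exact: erefl|exact: rec (Kit n _ kk) (Kit n _ kl)].
move=> k l kk kl; apply/eqP; rewrite -subr_eq0; apply/eqP.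
have l2 := K_L2 kl; have k2 := K_L2 kk.
(* Only the iterates of [k] become small; those of [l] stay below the norm of [l]. [MA] and [MB]
   bound squared norms and occur once for each argument of [Q]; the 2 comes from [cabsB2]. *)
apply: (@approx_eq0 _ _ ((2 * MA * MA + 2 * MB * MB) * sqnorm l)).
  by rewrite mulr_ge0 ?sqnorm_ge0 // addr_ge0 ?mulr_ge0.
move=> e e0; have [n ne] := iter_bshift_small (K_H2 kk) e0.
rewrite -/(Q k l) (recn n) // /Q.
have kx := Kit n k kk; have ky := Kit n l kl.
have yl : sqnorm (iter n (@bshift R) l) <= sqnorm l by exact: iter_bshift_sqnorm.
move: (iter n (@bshift R) k) (iter n (@bshift R) l) kx ky ne yl => x y kx ky xe yl.
apply: (le_trans (cabsB2 _ _)).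
have hA := cauchy_schwarz (K_L2 (KA _ kx)) (K_L2 (KA _ ky)).
have hB := cauchy_schwarz (K_L2 (KB _ kx)) (K_L2 (KB _ ky)).
have x0 := sqnorm_ge0 x; have y0 := sqnorm_ge0 y; have l0 := sqnorm_ge0 l.
have xy : sqnorm x * sqnorm y <= sqnorm l * e.
  by rewrite mulrC ler_pM // ltW.
have mA : sqnorm (A x) * sqnorm (A y) <= MA * MA * (sqnorm l * e).
  apply: (@le_trans _ _ ((MA * sqnorm x) * (MA * sqnorm y))).
    by rewrite ler_pM ?sqnorm_ge0 // bA.
  by rewrite mulrACA ler_wpM2l // mulr_ge0.
have mB : sqnorm (B x) * sqnorm (B y) <= MB * MB * (sqnorm l * e).
  apply: (@le_trans _ _ ((MB * sqnorm x) * (MB * sqnorm y))).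
    by rewrite ler_pM ?sqnorm_ge0 // bB.
  by rewrite mulrACA ler_wpM2l // mulr_ge0.
have := le_trans hA mA; have := le_trans hB mB.
move: (cabs _ ^+ 2) (cabs _ ^+ 2) => a b h1 h2.
have -> : (2 * MA * MA + 2 * MB * MB) * sqnorm l * e =
  2 * (MA * MA * (sqnorm l * e)) + 2 * (MB * MB * (sqnorm l * e)) by ring.
by lra.
Qed.

End Core.

(** * Removing the constant term of the symbol *)

Section Shifted.
Variables (phi psi : R -> C) (c : C).
Hypothesis phi2 : L2 phi.
Hypothesis phiE : forall t, phi t = psi t + c.
Variables (A B : (R -> C) -> R -> C).
Hypotheses (KA : forall f, K f -> K (A f)) (KB : forall f, K f -> K (B f)) (AB : adjK A B).

Lemma tto_pairing_sub : tto_pairing phi A -> tto_pairing psi (fun h t => A h t - c * h t).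
Proof.
move=> [_ pA]; split=> [f kf|f l kf kl lb]; first by apply: K_B; [exact: KA|exact: K_Z].
have f2 := K_L2 kf; have Af2 := K_L2 (KA kf); have l2 := K_L2 kl.
have pl := L2_bMJ phi2 lb (K_meas kl).
rewrite cinnerBl // cinnerZl // pA //.
have -> : (fun t => (psi t)^* * l t) = fun t => (phi t)^* * l t - c^* * l t.
  by apply/funext => t; rewrite phiE cconjD; ring.
by rewrite cinnerBr // cinnerZr // cconjK.
Qed.

Lemma adjK_sub : adjK (fun h t => A h t - c * h t) (fun h t => B h t - c^* * h t).
Proof.
move=> f g kf kg; have f2 := K_L2 kf; have Af2 := K_L2 (KA kf).
have g2 := K_L2 kg; have Bg2 := K_L2 (KB kg).
by rewrite cinnerBl // cinnerBr // cinnerZl // cinnerZr // cconjK AB.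
Qed.

(** The terms linear in [c] and in its conjugate are exchanged by the adjoint relation, and the
    quadratic ones coincide. *)
Lemma defect_sub k l : K k -> K l ->
  ip (fun t => A k t - c * k t) (fun t => A l t - c * l t) -
  ip (fun t => B k t - c^* * k t) (fun t => B l t - c^* * l t) =
  ip (A k) (A l) - ip (B k) (B l).
Proof.
move=> kk kl; have k2 := K_L2 kk; have l2 := K_L2 kl.
have Ak2 := K_L2 (KA kk); have Bk2 := K_L2 (KB kk).
have Al2 := K_L2 (KA kl); have Bl2 := K_L2 (KB kl).
have e1 : ip k (A l) = ip (B k) l.
  by rewrite (cinnerC Al2 k2) AB // -cinnerC.
have e2 := AB kk kl.
rewrite cinnerBl // (cinnerBl Bk2 _ _) // !cinnerZl // !(cinnerBr, cinnerZr) //.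
by rewrite e1 e2 cconjK; generalize_inner; ring.
Qed.

Lemma sqnorm_bounded_sub M : sqnorm_bounded A M ->
  sqnorm_bounded (fun h t => A h t - c * h t) (2 * M + 2 * cabs c ^+ 2).
Proof.
move=> [M0 bA]; split; first by have := sqr_ge0 (cabs c); lra.
move=> f kf; have f2 := K_L2 kf; have Af2 := K_L2 (KA kf).
have := sqnormD Af2 (L2N (L2Z c f2)); rewrite sqnormN sqnormZ // => h; apply: (le_trans h).
by have := bA _ kf; rewrite mulrDl -!mulrA; lra.
Qed.

End Shifted.

(** * Normality as a vanishing defect, and the equivalence *)

Lemma normal_defect A B : (forall f, K f -> K (A f)) -> (forall f, K f -> K (B f)) -> adjK A B ->
  ((forall f, K f -> aeeq (B (A f)) (A (B f))) <->
   (forall k l, K k -> K l -> ip (A k) (A l) = ip (B k) (B l))).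
Proof.
move=> KA KB AB; split=> [N k l kk kl|H f kf].
  have kAl := KA _ kl; have kBl := KB _ kl; have kBk := KB _ kk.
  have kBA := KB _ kAl; have kAB := KA _ kBl.
  have -> : ip (A k) (A l) = ip k (B (A l)) by exact: AB.
  have -> : ip k (B (A l)) = ip k (A (B l)).
    by apply: cinner_ae; [exact: K_meas|exact: K_meas|exact: K_meas|exact: K_meas|exact: ae_all|exact: N].
  by rewrite (cinnerC (K_L2 kAB) (K_L2 kk)) AB // -cinnerC.
have kAf := KA _ kf; have kBf := KB _ kf; have kBA := KB _ kAf; have kAB := KA _ kBf.
apply: K_eq => // l kl lb; have kAl := KA _ kl; have kBl := KB _ kl.
rewrite AB // -(H f l) //.
by rewrite (cinnerC (K_L2 kl) (K_L2 kBA)) -AB // -cinnerC.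
Qed.

Lemma is_tto_ext_props phi A : L2 phi -> is_tto_ext th phi A ->
  [/\ forall f, K f -> K (A f), compresses phi A, subtractive A & exists M, sqnorm_bounded A M].
Proof.
move=> p2 [KA lin [M bA] pA]; split => //.
- move=> f g kf fb kg; have [_ /(_ g kg)] := pA f kf fb.
  have f2 := K_L2 kf; have Af2 := K_L2 (KA _ kf); have pf := L2_bM p2 fb (K_meas kf).
  by rewrite cinnerBl // => /eqP; rewrite subr_eq0 => /eqP.
- move=> f g l kf kg kl; have f2 := K_L2 kf; have g2 := K_L2 kg; have l2 := K_L2 kl.
  have Af2 := K_L2 (KA _ kf); have Ag2 := K_L2 (KA _ kg).
  have e := lin (-1) g f kg kf.
  have fe : (fun t => -1 * g t + f t) = fun t => f t - g t.
    by apply/funext => t; rewrite mulN1r addrC.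
  have fe' : (fun t => -1 * A g t + A f t) = fun t => A f t - A g t.
    by apply/funext => t; rewrite mulN1r addrC.
  rewrite fe fe' in e; rewrite -cinnerBl //.
  apply: cinner_ae => //; [exact: K_meas (KA _ (K_B kf kg))
    |exact: K_meas (K_B (KA _ kf) (KA _ kg))|exact: K_meas|exact: K_meas|exact: ae_all].
(* Squaring passes from norms to [sqnorm] and gives a nonnegative constant whatever the sign of
   [M]. *)
- exists (M ^+ 2); split; first exact: sqr_ge0.
  move=> f kf; have := bA f kf; rewrite !cnormE => h.
  have s0 := sqrtr_ge0 (sqnorm (A f)).
  rewrite -(sqr_sqrtr (sqnorm_ge0 (A f))) -(sqr_sqrtr (sqnorm_ge0 f)) -exprMn.
  by rewrite ler_sqr ?nnegrE // (le_trans s0 h).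
Qed.

Lemma conjK_bound A M : (forall f, K f -> K (A f)) -> sqnorm_bounded A M ->
  sqnorm_bounded (fun h => conjK (A (conjK h))) M.
Proof.
move=> KA [M0 bA]; split => // f kf; have kc := K_conjK kf.
rewrite conjK_sqnorm; last exact/K_L2/KA.
by rewrite -(conjK_sqnorm (K_L2 kf)); exact: bA.
Qed.

Theorem normal_tto_iff phi1 phi2 A : K phi1 -> K phi2 ->
  is_tto_ext th (fun t => phi1 t + (phi2 t)^*) A ->
  (normal_op th A <-> exists alpha : C, cabs alpha = 1 /\
     (aeeq (fun t => phi2 t - value_at_0 phi2) (fun t => alpha * (phi1 t - value_at_0 phi1)) \/
      aeeq (fun t => phi2 t - value_at_0 phi2)
           (fun t => alpha * th t * ((phi1 t)^* - (value_at_0 phi1)^*)))).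
Proof.
move=> k1 k2 extA; have k12 := K_L2 k1; have k22 := K_L2 k2.
pose phi t := phi1 t + (phi2 t)^*.
have phiL2 : L2 phi by rewrite /phi; apply: L2D => //; exact: L2J.
have [KA cA sA [M bA]] := is_tto_ext_props phiL2 extA.
have TA := compresses_tto_pairing phiL2 KA cA sA bA.
pose f t := phi1 t - value_at_0 phi1; pose g t := phi2 t - value_at_0 phi2.
have kf : K f by apply: K_B => //; exact: K_cst.
have kg : K g by apply: K_B => //; exact: K_cst.
have v1 : value_at_0 one = 1 by rewrite value_at_0E -zn0E ip_zn_zn.
have v0 u : K u -> value_at_0 (fun t => u t - value_at_0 u) = 0.
  move=> ku; have u2 := K_L2 ku.
  by rewrite value_at_0E cinnerBl // ip_cstl // v1 cconj1 mulr1 -value_at_0E subrr.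
have f0 : value_at_0 f = 0 by exact: v0.
have g0 : value_at_0 g = 0 by exact: v0.
have f2 := K_L2 kf; have g2 := K_L2 kg.
pose c := value_at_0 phi1 + (value_at_0 phi2)^*.
have phiE t : phi t = (f t + (g t)^*) + c by rewrite /phi /f /g /c cconjB; ring.
have phiE' t : (phi t)^* = (g t + (f t)^*) + c^* by rewrite phiE !(cconjD, cconjK); ring.
pose A0 h t := A h t - c * h t.
have TA0 : tto_pairing (fun t => f t + (g t)^*) A0 by exact: (tto_pairing_sub phiL2 phiE KA TA).
have defect B : (forall f, K f -> K (B f)) -> adjK A B -> [/\
    tto_pairing (fun t => g t + (f t)^*) (fun h t => B h t - c^* * h t),
    adjK A0 (fun h t => B h t - c^* * h t) &
    forall k l, K k -> K l -> (ip (A k) (A l) = ip (B k) (B l) <->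
    ip (A0 k) (A0 l) = ip (fun t => B k t - c^* * k t) (fun t => B l t - c^* * l t))].
  move=> KB AB; split.
  - exact: (tto_pairing_sub (L2J phiL2) phiE' KB (adjK_tto_pairing phiL2 cA AB KA KB)).
  - exact: adjK_sub.
  - move=> k l kk kl; have e := defect_sub c KA KB AB kk kl.
    by split=> h; apply/eqP; rewrite -subr_eq0; [rewrite e h subrr|rewrite -e h subrr].
have twist alpha : (fun t => alpha * th t * ((phi1 t)^* - (value_at_0 phi1)^*)) =
    fun t => alpha * (th t * (f t)^*).
  by apply/funext => t; rewrite /f cconjB mulrA.
split=> [[B [[KB AB] N]]|[al [al1 cond]]].
  have [TB0 AB0 d] := defect B KB AB.
  have H := (normal_defect KA KB AB).1 N.
  have [|al [al1 h]] := defect_zero_symbols kf kg f0 g0 TA0 TB0.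
    by move=> k l kk kl; exact: ((d k l kk kl).1 (H k l kk kl)).
  by exists al; split => //; rewrite twist.
(* Normality asks for an adjoint to be exhibited; complex symmetry provides it explicitly. *)
pose B h := conjK (A (conjK h)).
have KB h : K h -> K (B h) by move=> kh; apply/K_conjK/KA/K_conjK.
have AB : adjK A B by exact: (conjK_adj phiL2 KA cA sA bA).
have [TB0 AB0 d] := defect B KB AB.
exists B; split; first by split.
apply: ((normal_defect KA KB AB).2 _) => k l kk kl; apply: ((d k l kk kl).2 _); move: k l kk kl.
have bB := conjK_bound KA bA.
have alJ : al * al^* = 1 by rewrite mulcJ al1 expr1n.
have alJ2 : al^* * (al^*)^* = 1 by rewrite cconjK mulrC.
have ff2 : L2 (fun t => th t * (f t)^*) by [].
have gg2 : L2 (fun t => th t * (g t)^*) by [].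
have swap (h u : R -> C) (b : C) : L2 h -> L2 u -> aeeq h (fun t => b * u t) ->
    forall k, K k -> ip k h = b^* * ip k u.
  move=> h2 u2 hu k kk; have kk2 := K_L2 kk; rewrite -cinnerZr //.
  apply: cinner_ae => //; [exact: K_meas|exact: K_meas|by case: h2|by case: (L2Z b u2)|exact: ae_all].
have prodJ (x y : C) (b : C) : b * b^* = 1 -> b^* * x * (b^* * y)^* = x * y^*.
  by move=> bb; rewrite cconjM cconjK mulrACA (mulrC b^*) bb mul1r.
apply: (symbols_defect_zero kf kg f0 g0 TA0 TB0 AB0 (sqnorm_bounded_sub c KA bA) (sqnorm_bounded_sub c^* KB bB)).
- case: cond => [h|]; last rewrite twist => h.
    apply: (ae_imp _ h) => t e tc; have := e tc; rewrite -/(f t) -/(g t) => ->.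
    rewrite cconjM; transitivity (al * f t * f t + (al * al^*) * (f t * (f t)^*)); last by ring.
    by rewrite alJ; ring.
  apply: (ae_imp _ (ae_and h thJ)) => t [e e'] tc; have := e tc; rewrite -/(g t) => ->.
  rewrite !(cconjM, cconjK).
  transitivity ((al * al^*) * (th t * (th t)^*) * (f t * (f t)^*) + al * th t * (f t)^* * f t); last by ring.
  by rewrite alJ (e' tc); ring.
- have fg u : L2 u -> aeeq g (fun t => al * u t) -> ip g g = ip u u.
    move=> u2 gu; have mg := L2_meas g2; have mu' := L2_meas (L2Z al u2).
    rewrite (cinner_ae mg mu' mg mu' gu gu).
    by rewrite cinnerZl // cinnerZr // mulrA alJ mul1r.
  case: cond => [h|]; last rewrite twist => h; first by rewrite (fg f).
  by rewrite (fg _ ff2 h) ip_th // ipJ.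
(* In the first alternative the [g] term equals the [f] term and the two twisted terms agree. In the
   second, [g] is a unimodular multiple of the twist of [f] and conversely, so each side vanishes
   separately. *)
- case: cond => [h|]; last rewrite twist => h; move=> k l kk kl.
    have e1 := swap g f al g2 f2 h.
    have gt : aeeq (fun t => th t * (g t)^*) (fun t => al^* * (th t * (f t)^*)).
      apply: (ae_imp _ h) => t e tc; have := e tc; rewrite -/(g t) -/(f t) => ->.
      by rewrite cconjM; ring.
    have e2 := swap _ _ _ gg2 ff2 gt.
    by rewrite (e1 _ kk) (e1 _ kl) (e2 _ kk) (e2 _ kl) (prodJ _ _ _ alJ) (prodJ _ _ _ alJ2).
  have e1 := swap _ _ _ g2 ff2 h.
  have gt : aeeq (fun t => th t * (g t)^*) (fun t => al^* * f t).
    apply: (ae_imp _ (ae_and h thJ)) => t [e e'] tc; have := e tc; rewrite -/(g t) => ->.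
    by rewrite !(cconjM, cconjK) -[RHS]mul1r -(e' tc); ring.
  have e2 := swap _ _ _ gg2 f2 gt.
  rewrite (e1 _ kk) (e1 _ kl) (e2 _ kk) (e2 _ kl) (prodJ _ _ _ alJ) (prodJ _ _ _ alJ2).
  by rewrite !subrr.
Qed.

End ModelSpace.

Local Open Scope complex_scope.

Theorem theorem2p5 (R : realType) (th phi1 phi2 : R -> R[i]) :
  inner_fun th -> nonconstant th -> value_at_0 th = 0 ->
  model_space th phi1 -> model_space th phi2 ->
  let phi := fun t => phi1 t + (phi2 t)^* in
  tto_bounded th phi ->
  forall A : (R -> R[i]) -> (R -> R[i]), is_tto_ext th phi A ->
  (normal_op th A <->
   exists alpha : R[i], cabs alpha = 1 /\
     (aeeq (fun t => phi2 t - value_at_0 phi2)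
           (fun t => alpha * (phi1 t - value_at_0 phi1)) \/
      aeeq (fun t => phi2 t - value_at_0 phi2)
           (fun t => alpha * th t * ((phi1 t)^* - (value_at_0 phi1)^*)))).
Proof.
by move=> th_inner _ th_0 k1 k2 phi _ A extA; exact: normal_tto_iff.
Qed.
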